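(* Let $h\in H$ and let $a$ be a reduced lift of $h$. (a) There is a bijection $$\mathcal S_a=\left\{\ell\in\mathbb Z^{\mathcal N}(a)\ \Big|\ \begin{array}{ll}0\le N_a(\ell,n), & n\in\mathcal N\setminus\widehat{\mathcal N}\\ 0\le N_a(\ell,n)\le\delta_{n,\mathcal N}-2, & n\in\widehat{\mathcal N}\end{array}\right\}\longrightarrow\mathcal X_h,$$ sending $\ell$ to $x=\sum_{v\in\mathcal N\cup\mathcal E}x_vE_v^*$ given by $x_n=N_a(\ell,n)$ for $n\in\mathcal N$ and $x_u=\alpha_u\left\{\frac{a_u-\omega_u\ell_n}{\alpha_u}\right\}$ for $u\in\mathcal E_n$, $n\in\mathcal N$. (b) If $x$ corresponds to $\ell$ under this bijection, then $\mathbf t_{\mathcal N}^x=\mathbf t^{\mathbf c_a+\ell}=\prod_{n\in\mathcal N}t_n^{c_n+\ell_n}$, where $\mathbf c_a=\sum_{n\in\mathcal N}c_nE_n$. (c) The $h$-equivariant part of the reduced Poincaré series equals $$Z_h(\mathbf t_{\mathcal N})=\sum_{\ell\in\mathcal S_a}\ \prod_{n'\in\mathcal N:\ \delta_{n',\mathcal N}>2}(-1)^{N_a(\ell,n')}\binom{\delta_{n',\mathcal N}-2}{N_a(\ell,n')}\cdot\mathbf t^{\mathbf c_a+\ell}.$$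
   Context: **Graph and lattices.** $\Gamma$ is a connected negative definite plumbing tree with vertex set $\mathcal V$, all genera $0$, integer decorations $b_v$, which is the dual graph of the minimal good resolution of a normal surface singularity (so $b_v\le -2$ whenever the valency $\delta_v\le 2$); $M$ is its plumbed 3-manifold (a rational homology sphere). $L=\bigoplus_{v\in\mathcal V}\mathbb Z E_v$ has the negative definite form $(E_v,E_v)=b_v$, $(E_v,E_w)=1$ if $v\neq w$ are adjacent, $0$ otherwise. $L'=\{l'\in L\otimes\mathbb Q:(l',L)\subset\mathbb Z\}\supset L$ is freely generated by $E_v^*$, where $(E_v^*,E_w)=-1$ if $v=w$ and $0$ otherwise. $H=L'/L\simeq H_1(M,\mathbb Z)$, $[l']$ is the class of $l'$. **Nodes and Seifert invariants.** $\mathcal N=\{n:\delta_n\ge 3\}$ is the set of nodes (assumed nonempty), $\mathcal E=\{u:\delta_u=1\}$ the set of ends. For $n\in\mathcal N$, $\mathcal N_n$ is the set of nodes $n'\ne n$ such that the path from $n$ to $n'$ has no node in its interior $(n,n')$ (neighbouring nodes); $\mathcal E_n$ is the set of ends $u$ such that the path $(n,u]$ ($n$ excluded) contains no node. $\delta_{n,\mathcal N}=|\mathcal N_n|$, $\widehat{\mathcal N}=\{n\in\mathcal N:\delta_{n,\mathcal N}\ge 2\}$. For a full subgraph, $\det$ denotes the determinant of the negative of its intersection matrix ($1$ for the empty graph). For $u\in\mathcal E_n$: $\alpha_u=\det_{(n,u]}$ and $\omega_u$ is the determinant of $(n,u]$ with the vertex adjacent to $n$ deleted. For $n'\in\mathcal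 N_n$: $\alpha_{n,n'}=\alpha_{n',n}=\det_{(n,n')}$ and $\omega_{n,n'}$ is the determinant of $(n,n')$ with the vertex adjacent to $n$ deleted; if $(n,n')=\emptyset$ put $\alpha_{n,n'}=1$, $\omega_{n,n'}=0$. **Reduced lifts.** For each pair of neighbouring nodes fix an order $n<n'$ or $n'<n$; sums over $n'>n$ or $n'<n$ run over neighbouring nodes $n'\in\mathcal N_n$, and ''$n<n'$'' always refers to neighbouring nodes. For $n<n'$, $n_{n'}$ is the vertex adjacent to $n$ on the path from $n$ to $n'$ ($n_{n'}=n'$ if $(n,n')=\emptyset$). A reduced lift of $h\in H$ is an element $a=\sum_{n\in\mathcal N}a_nE_n^*+\sum_{u\in\mathcal E}a_uE_u^*+\sum_{n<n'}a_{n_{n'}}E^*_{n_{n'}}\in L'$, given with its integer coefficients (coefficient $a_{n_{n'}}$ is kept separate from $a_{n'}$ if $(n,n')=\emptyset$), such that $[a]=h$. $\pi_{\mathcal N}:\mathbb R\langle E_v\rangle_{v\in\mathcal V}\to\mathbb R\langle E_n\rangle_{n\in\mathcal N}$ is the coordinate projection and $\mathbf c_a:=\pi_{\mathcal N}(a)$. **Poincaré series.** $\mathbf t^{l'}=\prod_v t_v^{l_v}$ for $l'=\sum_v l_vE_v$; $\mathbf t_{\mathcal N}^{x}:=\mathbf t^{\pi_{\mathcal N}(x)}$. Let $Z_H(\mathbf t)=\sum_{l'}p_{l'}[l']\mathbf t^{l'}$ be the Taylor expansion at the origin of $f_H(\mathbf t)=\prod_{v\in\mathcal V}(1-[E_v^*]\mathbf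 t^{E_v^*})^{\delta_v-2}$ (coefficients in $\mathbb Z[H]$), $Z_h(\mathbf t)=\sum_{[l']=h}p_{l'}\mathbf t^{l'}$, and $Z_h(\mathbf t_{\mathcal N})=Z_h(\mathbf t)|_{t_v=1,\,v\notin\mathcal N}$. **Sets.** $\mathcal X_h$ is the set of $x=\sum_{v\in\mathcal N\cup\mathcal E}x_vE_v^*\in L'$ ($x_v\in\mathbb Z$) with $[x]=h$, $0\le x_u<\alpha_u$ for $u\in\mathcal E$, $0\le x_n$ for $n\in\mathcal N\setminus\widehat{\mathcal N}$, and $0\le x_n\le\delta_{n,\mathcal N}-2$ for $n\in\widehat{\mathcal N}$. $\mathbb Z^{\mathcal N}(a)=\{\ell=\sum_{n\in\mathcal N}\ell_nE_n:\ \ell_n\in\mathbb Z,\ \ell_n+\omega_{n',n}\ell_{n'}\equiv a_{n_{n'}}\ (\mathrm{mod}\ \alpha_{n,n'})\ \forall\, n<n'\}$. For $n\in\mathcal N$, $$N_a(\ell,n)=a_n+\sum_{n'>n}\frac{\omega_{n,n'}}{\alpha_{n,n'}}a_{n_{n'}}+\sum_{n'<n}\frac{1}{\alpha_{n,n'}}a_{n'_n}-\Big(b_n+\sum_{n'\in\mathcal N_n}\frac{\omega_{n,n'}}{\alpha_{n,n'}}\Big)\ell_n-\sum_{n'\in\mathcal N_n}\frac{\ell_{n'}}{\alpha_{n,n'}}+\sum_{u\in\mathcal E_n}\Big\lfloor\frac{a_u-\omega_u\ell_n}{\alpha_u}\Big\rfloor.$$ $\{\cdot\}$ denotes the fractional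 part.
   Formalization: Part (c) is stated only for graphs with at least two nodes; for a single node the printed formula fails (for E8, h=0, a=0 the coefficient of t^30 is 2, not 1), the true coefficient being N_a(ℓ,n)+1. *)

(* Defs.v *)
From mathcomp Require Import all_boot all_order all_algebra.
From mathcomp Require Import boolp classical_sets functions cardinality fsbigop.
From HB Require Import structures.

Set Implicit Arguments.
Unset Strict Implicit.
Unset Printing Implicit Defensive.

Import Order.TTheory GRing.Theory Num.Theory.
Local Open Scope ring_scope.

(* A formal series with integer coefficients and exponents in T is its         *)
(* coefficient function.  In fsum and conv the coefficientwise sums are        *)
(* finite-support sums (0 on an infinite support, which does not occur in the  *)
(* uses made of them below).                                                   *)
Definition series (T : Type) := T -> int.

Definition mono (T : choiceType) (g : T) : series T := fun x => (x == g)%:Z.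

Definition fsum (I : choiceType) (T : Type) (A : set I) (F : I -> series T) :
  series T := fun x => \sum_(i \in A) F i x.

Section Convolution.
Variable T : zmodType.
Implicit Types (g : T) (A B : series T).

Definition sone : series T := mono 0.

Definition conv A B : series T :=
  fun x => \sum_(y \in [set: T]%classic) A y * B (x - y).

(* 1 - s and its inverse sum_k s^k, for the monomial s with exponent g. *)
Definition one_minus g : series T := fun x => sone x - mono g x.

Definition geom g : series T :=
  fsum [set: nat]%classic (fun k => mono (g *+ k)).

(* Expansion at the origin of (1 - s)^m. *)
Definition pow_one_minus g (m : int) : series T :=
  match m with
  | Posz k => iter k (conv (one_minus g)) sone
  | Negz k => iter k.+1 (conv (geom g)) sone
  end.

Lemma conv_one_minus g B x : g != 0 ->
  conv (one_minus g) B x = B x - B (x - g).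
Proof.
move=> g0; rewrite /conv (fsbigE [:: 0; g]) /=; first last.
- move=> y _; rewrite !inE negb_or /one_minus /sone /mono.
  by case/andP=> /negPf-> /negPf->; rewrite subrr mul0r.
- by [].
- by rewrite inE eq_sym g0.
rewrite !big_cons big_nil !in_setT /one_minus /sone /mono !eqxx.
by rewrite [0 == g]eq_sym (negPf g0) !subr0 sub0r mul1r mulN1r /=.
Qed.

Lemma conv_one_minus_geom g : (forall k, g *+ k.+1 != 0) ->
  conv (one_minus g) (geom g) = sone.
Proof.
move=> gk; have gI : injective (fun k => g *+ k).
  move=> i j; wlog: i j / (i <= j)%N => [W|].
    by case: (leqP i j) => [/W|/ltnW /W Wij /esym/Wij].
  move=> /subnKC <- /esym/eqP; rewrite mulrnDr -subr_eq0 addrAC subrr add0r.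
  by case: (j - i)%N => [|k]; [rewrite addn0|rewrite (negPf (gk k))].
have geomS k : geom g (g *+ k) = 1.
  rewrite /geom /fsum (fsbigE [:: k]) //=; last first.
    by move=> i _; rewrite /mono inE (inj_eq gI) eq_sym => /negPf->.
  by rewrite big_cons big_nil in_setT /mono eqxx.
have geom0 x : (forall k, x != g *+ k) -> geom g x = 0.
  by move=> xN; rewrite /geom /fsum fsbig1 // => k _; rewrite /mono (negPf (xN k)).
apply/funext => x; rewrite conv_one_minus ?(gk 0)// /sone /mono.
have [-> | x0] := eqVneq x 0.
  rewrite (geomS 0) sub0r geom0 ?subr0 // => k.
  by rewrite eq_sym -subr_eq0 opprK -mulrSr gk.
have [[k xk]|xN] := pselect (exists k, x = g *+ k).
  case: k => [|k] in xk; first by rewrite xk eqxx in x0.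
  by rewrite xk geomS mulrSr addrK geomS subrr.
rewrite !geom0 ?subr0 // => k; apply/eqP => xk; apply: xN; last by exists k.
by exists k.+1; rewrite mulrSr -xk subrK.
Qed.

End Convolution.

Definition frac (q : rat) : rat := q - (Num.floor q)%:~R.

Section RationalVectors.
Variable I : finType.

Definition Evec (i : I) : {ffun I -> rat} := [ffun j => (i == j)%:R].

Definition scaleQ (q : rat) (x : {ffun I -> rat}) : {ffun I -> rat} :=
  [ffun i => q * x i].

End RationalVectors.

(* All genera are 0. *)
Record plumbing := Plumbing {
  vertex :> finType;
  adj : rel vertex;
  euler : vertex -> int }.

(* The lattice of integral vectors in the rational span of the E_v. *)
Definition latL (V : finType) : {pred {ffun V -> rat}} :=
  fun x => [forall v, x v \is a Num.int].
Arguments latL : clear implicits.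

Fact latL_zmod_closed (V : finType) : zmod_closed (latL V).
Proof.
split=> [|x y /forallP xL /forallP yL]; apply/forallP=> v.
  by rewrite ffunE rpred0.
by rewrite !ffunE rpredB.
Qed.

HB.instance Definition _ (V : finType) :=
  GRing.isZmodClosed.Build {ffun V -> rat} (latL V) (latL_zmod_closed V).

Section Plumbing.
Variable G : plumbing.
Implicit Types (v w : G).

Definition is_tree : Prop :=
  [/\ symmetric (@adj G), irreflexive (@adj G),
      forall v w, connect (@adj G) v w
    & forall c : seq G, cycle (@adj G) c -> uniq c -> (size c <= 2)%N].

Definition valency v : nat := #|[set w | adj v w]|.

Definition inter v w : int :=
  if v == w then euler v else (adj v w)%:Z.

(* L (x) Q, in the basis of the E_v. *)
Local Notation QL := {ffun G -> rat}.

Definition form (x y : QL) : rat :=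
  \sum_v \sum_w x v * (inter v w)%:~R * y w.

Definition negative_definite : Prop := forall x : QL, x != 0 -> form x x < 0.

Definition dualL : set QL :=
  [set x | forall y : QL, y \in latL G -> form x y \is a Num.int]%classic.

(* H = L'/L, as the subgroup of classes of elements of L' in (L (x) Q)/L. *)
Definition QLmodL : zmodType := Quotient.quot (latL G).
Definition class (x : QL) : QLmodL :=
  \pi_(Quotient.quot (latL G))%qT x.
Definition Hgrp : set QLmodL := (class @` dualL)%classic.

(* The coordinates of the E*_v are the rows of minus the inverse of the        *)
(* intersection matrix, see form_Estar.                                        *)
Definition neg_inter_mx : 'M[rat]_#|G| :=
  \matrix_(i, j) - (inter (enum_val i) (enum_val j))%:~R.

Definition Estar v : QL :=
  [ffun w => invmx neg_inter_mx (enum_rank v) (enum_rank w)].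

Lemma form_Evec (x : QL) w : form x (Evec w) = \sum_v x v * (inter v w)%:~R.
Proof.
apply: eq_bigr => v _; rewrite (bigD1 w) //= ffunE eqxx mulr1 big1 ?addr0 //.
by move=> u; rewrite ffunE eq_sym => /negPf->; rewrite mulr0.
Qed.

Lemma form_Estar : negative_definite ->
  forall v w, form (Estar v) (Evec w) = - (v == w)%:R.
Proof.
move=> nd v w; have uM : neg_inter_mx \in unitmx.
  rewrite -row_free_unit -kermx_eq0; apply/eqP/row_matrixP => i.
  rewrite row0; set r := row i _.
  have rM : r *m neg_inter_mx = 0 by rewrite -row_mul mulmx_ker row0.
  pose x : QL := [ffun u => r 0 (enum_rank u)].
  have [x0|/nd] := eqVneq x 0.
    apply/rowP => j; move/ffunP: x0 => /(_ (enum_val j)).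
    by rewrite !ffunE enum_valK => ->; rewrite mxE.
  suff -> : form x x = 0 by rewrite ltxx.
  rewrite /form exchange_big /= big1 // => u _; rewrite -mulr_suml.
  suff -> : \sum_z x z * (inter z u)%:~R = 0 by rewrite mul0r.
  have := congr1 (fun A : 'rV_#|G| => A 0 (enum_rank u)) rM.
  rewrite !mxE (reindex (@enum_rank G)) /=; last first.
    by apply: onW_bij; apply: enum_rank_bij.
  move=> /eqP; rewrite -oppr_eq0 -sumrN => /eqP rM0; rewrite -[RHS]rM0.
  apply: eq_bigr => z _.
  by rewrite [neg_inter_mx _ _]mxE !enum_rankK ffunE mulrN opprK.
rewrite form_Evec.
have := congr1 (fun A : 'M_#|G| => A (enum_rank v) (enum_rank w)) (mulVmx uM).
rewrite !mxE (inj_eq enum_rank_inj) => <-.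
rewrite (reindex (@enum_rank G)) /=; last first.
  by apply: onW_bij; apply: enum_rank_bij.
rewrite -sumrN; apply: eq_bigr => z _.
by rewrite !mxE !ffunE !enum_rankK mulrN opprK.
Qed.

Definition minimal : Prop :=
  forall v, (valency v <= 2)%N -> euler v <= - 2%:Z.

Definition node : finType := {v : G | (3 <= valency v)%N}.
Definition leaf : finType := {v : G | valency v == 1%N}.

(* The vertices of the path from x to y, without x; in a tree there is exactly *)
(* one simple path, and its length is less than #|G|.                          *)
Definition tpath (x y : G) : seq G :=
  if [pick p : #|G|.-bseq G |
        [&& path (@adj G) x p, uniq (x :: p) & last x p == y]] is Some p
  then p else [::].

Definition interior (x y : G) : seq G := [seq w <- tpath x y | w != y].

Definition det_sub (S : {set G}) : int :=
  \det (\matrix_(i < #|S|, j < #|S|) - inter (enum_val i) (enum_val j)).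

Implicit Types (n : node) (u : leaf).

Definition has_node (s : seq G) : bool := has (fun w => 3 <= valency w)%N s.

Definition nbr_nodes n : {set node} :=
  [set n' | (n' != n) && ~~ has_node (interior (val n) (val n'))].

Definition node_leaves n : {set leaf} :=
  [set u | ~~ has_node (tpath (val n) (val u))].

Definition delta_nodes n : nat := #|nbr_nodes n|.

Definition hat_nodes : {set node} := [set n | 2 <= delta_nodes n]%N.

Definition alpha_leaf n u : int := det_sub [set w in tpath (val n) (val u)].

Definition omega_leaf n u : int :=
  det_sub [set w in behead (tpath (val n) (val u))].

Definition alpha n n' : int := det_sub [set w in interior (val n) (val n')].

Definition omega n n' : int :=
  let s := interior (val n) (val n') in
  if s is [::] then 0 else det_sub [set w in behead s].

(* The vertex n_{n'} adjacent to n on the path from n to n'. *)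
Definition first_vertex n n' : G := head (val n) (tpath (val n) (val n')).

(* The order is only a choice for each pair of neighbouring nodes; it need not *)
(* be transitive.                                                              *)
Definition is_orientation (lt : rel node) : Prop :=
  forall n n', n' \in nbr_nodes n -> lt n n' (+) lt n' n.

(* The integers a_n, a_u and, for neighbouring n < n', a_{n_{n'}}; the values  *)
(* of lift_first on other pairs are never used.                                *)
Record lift_coef := LiftCoef {
  lift_node : node -> int;
  lift_leaf : leaf -> int;
  lift_first : node -> node -> int }.

Variable lt : rel node.
Variable a : lift_coef.

Definition lift_vec : QL :=
  \sum_n Estar (val n) *~ lift_node a n
  + \sum_u Estar (val u) *~ lift_leaf a u
  + \sum_n \sum_(n' in nbr_nodes n | lt n n')
      Estar (first_vertex n n') *~ lift_first a n n'.

Definition is_reduced_lift (h : QLmodL) : Prop := class lift_vec = h.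

Local Notation QN := {ffun node -> rat}.
Local Notation ZN := {ffun node -> int}.

Definition piN (x : QL) : QN := [ffun n => x (val n)].

Definition c_vec : QN := piN lift_vec.

Definition ratN (l : ZN) : QN := [ffun n => (l n)%:~R].

Definition ZNa : set ZN :=
  [set l : ZN | forall n n', n' \in nbr_nodes n -> lt n n' ->
     (l n + omega n' n * l n' = lift_first a n n' %[mod alpha n n'])%Z]%classic.

Definition Na (l : ZN) n : rat :=
  (lift_node a n)%:~R
  + \sum_(n' in nbr_nodes n | lt n n')
      (omega n n')%:~R / (alpha n n')%:~R * (lift_first a n n')%:~R
  + \sum_(n' in nbr_nodes n | lt n' n)
      1 / (alpha n n')%:~R * (lift_first a n' n)%:~R
  - ((euler (val n))%:~R
     + \sum_(n' in nbr_nodes n) (omega n n')%:~R / (alpha n n')%:~R)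
    * (l n)%:~R
  - \sum_(n' in nbr_nodes n) (l n')%:~R / (alpha n n')%:~R
  + \sum_(u in node_leaves n)
      (Num.floor ((lift_leaf a u - omega_leaf n u * l n)%:~R
                  / (alpha_leaf n u)%:~R : rat))%:~R.

Definition Sa : set ZN :=
  [set l : ZN | ZNa l /\
     forall n, 0 <= Na l n /\
       (n \in hat_nodes -> Na l n <= (delta_nodes n)%:R - 2)]%classic.

(* Each leaf lies in node_leaves n for exactly one node n. *)
Definition Xh (h : QLmodL) : set QL :=
  [set x : QL | exists (xN : node -> int) (xE : leaf -> int),
     [/\ x = \sum_n Estar (val n) *~ xN n + \sum_u Estar (val u) *~ xE u,
         class x = h,
         forall n u, u \in node_leaves n -> 0 <= xE u < alpha_leaf n u
       & forall n, 0 <= xN n /\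
           (n \in hat_nodes -> xN n <= (delta_nodes n)%:Z - 2)]]%classic.

Definition x_of (l : ZN) : QL :=
  \sum_n scaleQ (Na l n) (Estar (val n))
  + \sum_n \sum_(u in node_leaves n)
      scaleQ ((alpha_leaf n u)%:~R
              * frac ((lift_leaf a u - omega_leaf n u * l n)%:~R
                      / (alpha_leaf n u)%:~R)) (Estar (val u)).

(* t_N^x *)
Definition tN (x : QL) : series QN := mono (piN x).

(* An exponent (x, g) stands for g t^x, so that a series with these exponents  *)
(* is a series in t with coefficients in the group ring; this is the expansion *)
(* of prod_v (1 - [E*_v] t^(E*_v))^(delta_v - 2).                              *)
Definition Z_H : series (QL * QLmodL)%type :=
  \big[@conv _/@sone _]_v
    pow_one_minus (Estar v, class (Estar v)) ((valency v)%:Z - 2).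

Definition coef_p (x : QL) : int := Z_H (x, class x).

Definition Z_h (h : QLmodL) : series QL :=
  fsum [set x : QL | dualL x /\ class x = h]%classic
    (fun x y => coef_p x * mono x y).

(* Substitution of t_v = 1 for the v that are not nodes. *)
Definition reduce_nodes (Z : series QL) : series QN :=
  fsum [set: QL]%classic (fun x y => Z x * tN x y).

(* On Sa the value Na l n is a natural number. *)
Definition coef_S (l : ZN) : int :=
  \prod_(n | (2 < delta_nodes n)%N)
    ((-1) ^+ Num.truncn (Na l n)
     * 'C(delta_nodes n - 2, Num.truncn (Na l n))%:R).

End Plumbing.

Arguments is_tree : clear implicits.
Arguments negative_definite : clear implicits.
Arguments minimal : clear implicits.
Arguments Hgrp : clear implicits.
Arguments Z_H : clear implicits.

(* Main.v *)
Require Import Defs.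
From HB Require Import structures.
From mathcomp Require Import all_boot all_order perm all_algebra.
From mathcomp Require Import boolp classical_sets functions cardinality fsbigop.
From mathcomp Require Import ring lra zify.

Set Implicit Arguments.
Unset Strict Implicit.
Unset Printing Implicit Defensive.

Import Order.TTheory GRing.Theory Num.Theory.
Local Open Scope ring_scope.

(** Write a point x of L' in the dual basis E*_v. Its coordinate on E*_v is
    minus the pairing of x with E_v, that is -b_v x_v minus the sum of the
    x_w over the neighbours w of v ([dcoord_inter]). Prescribing the dual
    coordinates of a + y, for y in L, thus means prescribing a linear
    recurrence for y along the tree.

    Along a chain of vertices of valency two the recurrence is solved by
    continuants ([chain_rec_solve]), which are the determinants alpha and
    omega ([det_sub_continuant]). So y is determined by its values l_n at
    the nodes together with one integer f_u for each leaf u, namely minus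
    the value of y at the vertex next to the node on the chain towards u;
    and y is integral on a chain between two nodes exactly when l satisfies
    the congruence of Z^N(a) for this chain. The coordinate of a + y on E*_n
    comes out as N_a(l,n) with every floor replaced by f_u, and the one on
    E*_u as a_u - omega_u l_n - alpha_u f_u ([node_equation],
    [inner_leaf_chain]). Conversely the form is definite on the span of the
    vertices that are not nodes, so every choice of l and f is realised by a
    rational y ([dcoord_extension]). Altogether ([lift_point_translate],
    [lift_point_surj]) the pairs (l, f) with l in Z^N(a) parametrize the
    points of a + L whose dual coordinates vanish at the vertices of valency
    two.

    Part (a) follows, because 0 <= x_u < alpha_u says that f_u is the floor
    ([free_leaf_floorP]); part (b) says that y has the values l_n at the
    nodes.

    For part (c), linear independence of the E*_v makes every coefficient of
    the product Z_H a product over the vertices v of a coefficient of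
    (1-s)^(delta_v - 2), taken at the coordinate on E*_v ([coef_pE]). Such a
    coefficient vanishes unless the point is one of those just parametrized.
    Fix the exponent of t_N, that is l, and put f_u = floor - j_u. Raising
    j_u by one adds alpha_u to the coordinate at the leaf u, where all
    coefficients of (1-s)^(-1) are 1, and lowers the coordinate at its node
    by one. Summing over j_u >= 0 therefore divides the factor of the node
    by 1-s, once for each leaf of the node ([sum_pow_coef_fibres]). What
    remains is (1-s)^(delta_(n,N) - 2), whose coefficient at N_a(l,n) is the
    signed binomial coefficient in the formula. *)

(** * Continuants and determinants of chains *)

Section Continuants.
Variable G : plumbing.
Implicit Types (v w : G) (s t : seq G).

(** The determinants of the tridiagonal matrices of a chain and of its tail,
    by the three-term recurrence. The second component is 0, not 1, on the
    empty chain: this is the value of omega for adjacent nodes, and it spares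
    [chain_rec_solve] a case distinction. *)
Fixpoint continuant_pair s : int * int :=
  if s is v :: t then
    (- euler v * (continuant_pair t).1 - (continuant_pair t).2,
     (continuant_pair t).1)
  else (1, 0).

Definition continuant s := (continuant_pair s).1.
Definition continuant_tail s := (continuant_pair s).2.

Lemma continuant_cons v t : continuant (v :: t) =
  - euler v * continuant t - continuant_tail t.
Proof. by []. Qed.

Lemma continuant_tail_cons v t : continuant_tail (v :: t) = continuant t.
Proof. by []. Qed.

(** Decorations at most -2 make the continuants increase with the chain; this
    is where minimality makes the alpha positive. *)
Lemma continuant_growth s : (forall v, v \in s -> euler v <= - 2%:Z) ->
  0 <= continuant_tail s < continuant s.
Proof.
elim: s => [//|v t IH] sP; rewrite continuant_cons continuant_tail_cons.
have /andP[t0 tlt] := IH (fun w (wt : w \in t) =>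
  sP w (@mem_behead _ (v :: t) w wt)).
have := sP v (mem_head _ _); nia.
Qed.

Definition inter_mx s : 'M[int]_(size s) :=
  \matrix_(i, j) - inter (tnth (in_tuple s) i) (tnth (in_tuple s) j).

(** Another enumeration of the vertices permutes rows and columns
    simultaneously. *)
Lemma det_sub_inter_mx s : uniq s -> det_sub [set w in s] = \det (inter_mx s).
Proof.
move=> us; rewrite /det_sub; set S := [set w in s].
have sz : #|S| = size s by rewrite cardsE (card_uniqP us).
have /tuple_permP[p pE] : perm_eq (enum S) (in_tuple s).
  by apply: uniq_perm; rewrite ?enum_uniq // => w; rewrite mem_enum inE.
set M : 'M_#|S| := \matrix_(i, j) _.
have -> : \det M = \det (castmx (sz, sz) M) by case: _ / sz.
have -> : castmx (sz, sz) M = row_perm p (col_perm p (inter_mx s)).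
  apply/matrixP => i j; rewrite castmxE !mxE.
  have eE (k : 'I_(size s)) :
      enum_val (cast_ord (esym sz) k) = tnth (in_tuple s) (p k).
    rewrite (enum_val_nth (tnth (in_tuple s) k)) /= pE.
    have := tnth_nth (tnth (in_tuple s) k)
      [tuple tnth (in_tuple s) (p i0) | i0 < _] k.
    by rewrite tnth_mktuple => ->.
  by rewrite !eE.
rewrite row_permE col_permE !det_mulmx !det_perm odd_permV mulrCA.
by rewrite -signr_addb addbb mulr1.
Qed.

(** Besides the diagonal term, the expansion along the first row leaves one
    minor, whose first column has a single nonzero entry. *)
Lemma det_inter_mx_cons2 v w t :
    (forall z, z \in t -> inter v z = 0 /\ inter z v = 0) ->
    inter v w = 1 -> inter w v = 1 ->
  \det (inter_mx [:: v, w & t]) =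
    - euler v * \det (inter_mx (w :: t)) - \det (inter_mx t).
Proof.
move=> vt vw wv; set M := inter_mx _.
have tnS x s (i : 'I_(size s)) :
    tnth (in_tuple (x :: s)) (lift ord0 i) = tnth (in_tuple s) i.
  by rewrite !(tnth_nth x).
have tn0 x s : tnth (in_tuple (x :: s)) ord0 = x by rewrite (tnth_nth x).
rewrite (expand_det_row _ ord0) 2!big_ord_recl big1 ?addr0 => [|i _];
  last first.
  by rewrite mxE tn0 !tnS (vt _ (mem_tnth _ (in_tuple t))).1 oppr0 mul0r.
congr (_ + _).
  rewrite mxE tn0 /inter eqxx /cofactor addn0 mul1r; congr (_ * \det _).
  by apply/matrixP => i j; rewrite !mxE !tnS.
rewrite mxE tn0 tnS tn0 vw /cofactor mulN1r expr1 mulN1r opprK.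
set N := row' _ _; rewrite (expand_det_col _ ord0) big_ord_recl big1 ?addr0.
  rewrite {1}/N !mxE tnS !tn0.
  have -> : lift (lift ord0 ord0) ord0 = ord0 :> 'I_(size t).+2.
    by apply: val_inj.
  rewrite tn0 wv mulN1r /cofactor mul1r; congr (- \det _).
  apply/matrixP => i j; rewrite !mxE !tnS.
  have -> : lift (lift ord0 ord0) (lift ord0 j) = lift ord0 (lift ord0 j)
    by apply: val_inj.
  by rewrite !tnS.
move=> i _; rewrite !mxE !tnS.
have -> : lift (lift ord0 ord0) ord0 = ord0 :> 'I_(size t).+2.
  by apply: val_inj.
by rewrite tn0 (vt _ (mem_tnth _ (in_tuple t))).2 oppr0 mul0r.
Qed.

Fixpoint straight s : Prop :=
  if s is v :: t then
    (forall z, z \in t -> inter v z = (z == head v t)%:Z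
                       /\ inter z v = (z == head v t)%:Z) /\ straight t
  else True.

Lemma det_inter_mx_continuant s :
  uniq s -> straight s -> \det (inter_mx s) = continuant s.
Proof.
suff: forall n t, (size t <= n)%N -> uniq t -> straight t ->
   \det (inter_mx t) = continuant t by apply; exact: leqnn.
elim=> [|n IH] [|v [|w t]] //= sz ut st; rewrite ?det_mx00 //.
  by rewrite det_mx11 mxE (tnth_nth v) /=
    /inter eqxx continuant_cons mulr1 subr0.
case: st => vt st; have [/= _ wt ut'] := (and3P ut).
have [] := vt w (mem_head _ _); rewrite eqxx => vw wv.
rewrite det_inter_mx_cons2 // => [|z zt]; last first.
  have [|-> ->] := vt z; first by rewrite inE zt orbT.
  by case: eqVneq => //= zw; rewrite -zw zt in wt.
have /= [_ st'] := st; rewrite (IH t) ?(IH (w :: t)) //= ?wt // ltnW //.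
Qed.

Lemma det_sub_continuant s :
  uniq s -> straight s -> det_sub [set w in s] = continuant s.
Proof. by move=> us ss; rewrite det_sub_inter_mx ?det_inter_mx_continuant. Qed.

Variable y : G -> rat.

Definition chain_next s (q : rat) := head q (map y s).

(** The boundary values p and q are free numbers, not values of y, so that an
    inhomogeneous term at either end of the chain can be absorbed into
    them. *)
Fixpoint chain_rec (p : rat) s (q : rat) : Prop :=
  if s is v :: t then
    - (euler v)%:~R * y v = p + chain_next t q /\ chain_rec (y v) t q
  else True.

(** The vertices are eliminated one by one from the far end, as in the
    evaluation of a continued fraction. *)
Lemma chain_rec_solve p s q : chain_rec p s q ->
  (continuant s)%:~R * chain_next s q = (continuant_tail s)%:~R * p + q.
Proof.
elim: s p => [|v t IH] p; first by rewrite /= mul1r mul0r add0r.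
rewrite continuant_cons continuant_tail_cons /= => -[vE /IH tE].
rewrite rmorphB rmorphM rmorphN /= mulrBl mulrAC vE mulrDl mulrC.
rewrite [chain_next t q * _]mulrC tE /chain_next /=; ring.
Qed.

Lemma chain_rec_rcons p s v q : chain_rec p (rcons s v) q <->
  chain_rec p s (y v) /\ - (euler v)%:~R * y v = last p (map y s) + q.
Proof.
elim: s p => [|w t IH] p /=; first by tauto.
have -> : chain_next (rcons t v) q = chain_next t (y v) by case: t {IH}.
by have := IH (y w); tauto.
Qed.

Lemma chain_rec_rev p s q : chain_rec p s q -> chain_rec q (rev s) p.
Proof.
elim: s p => [|v t IH] p //= [vE tE]; rewrite rev_cons.
apply/chain_rec_rcons; split; first exact: IH.
rewrite vE addrC; congr (_ + _); rewrite /chain_next map_rev.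
by case: t {IH vE tE} => //= w t; rewrite rev_cons last_rcons.
Qed.

(** The decorations are integers, so integrality at two consecutive places
    propagates. *)
Lemma chain_rec_int p s q : chain_rec p s q ->
    p \is a Num.int -> chain_next s q \is a Num.int ->
  forall v, v \in s -> y v \is a Num.int.
Proof.
elim: s p => [//|v t IH] p /= [vE tE] pZ vZ w; rewrite inE => /predU1P[-> //|].
apply: (IH _ tE vZ); rewrite -[chain_next _ _](addKr p) -vE.
by rewrite rpredD ?rpredM ?rpredN ?intr_int.
Qed.

End Continuants.

(** * Paths in a tree and chains issuing from a node *)

Section TreePaths.
Variable G : plumbing.
Hypothesis treeG : is_tree G.
Implicit Types (v w x z e : G) (s t p q : seq G).

Lemma adjC v w : adj v w = adj w v.
Proof. by case: treeG => + _ _ _; apply. Qed.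

Lemma adjN v : adj v v = false.
Proof. by case: treeG => _ + _ _; apply. Qed.

(** Two paths that separate at x and meet again close up, at their first
    common vertex, to a cycle of length at least three. *)
Lemma simple_path_uniq x p q :
    path (@adj G) x p -> uniq (x :: p) -> path (@adj G) x q -> uniq (x :: q) ->
  last x p = last x q -> p = q.
Proof.
elim: p x q => [|a p IH] x q.
  case: q => //= b q _ _ _ /andP[xN _] xE.
  by move: xN; rewrite xE mem_last.
case: q => /= [|b q].
  by move=> _ /andP[xN _] _ _ xE; move: xN; rewrite -xE mem_last.
move=> /andP[xa ap] /andP[xNp up] /andP[xb bq] /andP[xNq uq] lE.
have [ab|aNb] := eqVneq a b.
  by subst b; congr (_ :: _); apply: (IH a).
have hs : has (mem (b :: q)) (a :: p).
  by apply/hasP; exists (last a p); rewrite /= ?mem_last // lE mem_last.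
have {ap xa} : path (@adj G) x (a :: p) by rewrite /= xa.
have {bq xb} : path (@adj G) x (b :: q) by rewrite /= xb.
have hd : head x (a :: p) != head x (b :: q) by [].
have {up}upp : uniq (a :: p) by [].
have {uq}uqq : uniq (b :: q) by [].
move: (a :: p) (b :: q) hd hs xNp xNq upp uqq {lE IH aNb} => p' q' hd hs.
(* z is the first vertex of p' on q', so p1 does not meet q'. *)
case: (split_find hs) hd => z p1 p2 /= zq p1q;
  case/splitPr: zq p1q => q1 q2 p1q.
rewrite !mem_cat mem_rcons !inE !negb_or -!cats1 -catA /= => hd.
move=> /andP[/andP[xz xp1] _] /and3P[xq1 _ _].
rewrite !cat_uniq /= => /and3P[up1 /norP[zp1 _] _] /and3P[uq1 /norP[zq1 _] _].
rewrite !cat_path /= => /and3P[xq1P q1z _] /and3P[xp1P p1z _].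
have := treeG; case=> _ _ _ /(_ (x :: p1 ++ z :: rev q1)).
have -> : cycle (@adj G) (x :: p1 ++ z :: rev q1).
  rewrite /= rcons_cat cat_path xp1P /= p1z /=.
  have := rev_path (@adj G) x (rcons q1 z).
  rewrite last_rcons belast_rcons rev_cons => ->.
  by rewrite (eq_path (e' := @adj G)) ?rcons_path ?xq1P // => v w; rewrite adjC.
have -> : uniq (x :: p1 ++ z :: rev q1).
  rewrite /= cat_uniq /= !(mem_cat, inE, mem_rev, rev_uniq) negb_or xp1 /=.
  rewrite (negPf xz) xq1 up1 (negPf zp1) /= uq1 zq1 !andbT /=.
  apply/hasPn => w; rewrite mem_rev => wq1; apply/negP => wp1.
  by move/hasPn: p1q => /(_ w wp1); rewrite /= mem_cat wq1.
rewrite /= size_cat /= size_rev => /(_ isT isT).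
rewrite addnS !ltnS leqn0 addn_eq0 => /andP[/nilP p10 /nilP q10].
by rewrite p10 q10 /= eqxx in hd.
Qed.

Lemma tpathP x y : [/\ path (@adj G) x (tpath x y), uniq (x :: tpath x y)
  & last x (tpath x y) = y].
Proof.
rewrite /tpath; case: pickP => [p /and3P[-> -> /eqP]//|noP].
have [_ _ conn _] := treeG; have /connectP[p xp yE] := conn x y.
case: (shortenP xp) yE => q xq uq _ yE.
have sq : (size q <= #|G|)%N.
    by apply: ltnW; rewrite -[(size q).+1]/(size (x :: q)) -(card_uniqP uq)
      max_card.
by have /negP[] := noP (Bseq sq); rewrite xq uq yE eqxx.
Qed.

Lemma tpathE x y p :
  path (@adj G) x p -> uniq (x :: p) -> last x p = y -> tpath x y = p.
Proof.
move=> xp up lE; have [xq uq lE'] := tpathP x y.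
by apply: (simple_path_uniq xq uq xp up); rewrite lE lE'.
Qed.

Lemma tpath_rcons x s e : path (@adj G) x (rcons s e) ->
  uniq (x :: rcons s e) ->
  tpath x e = rcons s e /\ interior x e = s.
Proof.
move=> xs us; rewrite /interior (tpathE xs us) ?last_rcons //; split=> //.
move: us; rewrite /= rcons_uniq => /and3P[_ es _].
rewrite filter_rcons eqxx; apply/all_filterP/allP => w ws.
by apply: contra es => /eqP <-.
Qed.

Lemma interiorP x e : x != e -> [/\ tpath x e = rcons (interior x e) e,
  path (@adj G) x (rcons (interior x e) e)
  & uniq (x :: rcons (interior x e) e)].
Proof.
move=> xe; have [] := tpathP x e.
case/lastP E: (tpath x e) => [|s z].
  by move=> _ _ /= xE; rewrite xE eqxx in xe.
rewrite last_rcons => + + ze; rewrite {}ze => xs us.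
by have [_ ->] := tpath_rcons xs us.
Qed.

Lemma path_rev x s e : path (@adj G) x (rcons s e) ->
  path (@adj G) e (rcons (rev s) x).
Proof.
move=> xs; have := rev_path (@adj G) x (rcons s e).
rewrite last_rcons belast_rcons rev_cons => ->.
by rewrite (eq_path (e' := @adj G)) // => v w; rewrite adjC.
Qed.

Lemma uniq_rev x s e :
  uniq (x :: rcons s e) -> uniq (e :: rcons (rev s) x).
Proof. by rewrite -rev_uniq rev_cons rev_rcons. Qed.

Lemma tpath_rev x s e : path (@adj G) x (rcons s e) -> uniq (x :: rcons s e) ->
  tpath e x = rcons (rev s) x /\ interior e x = rev s.
Proof. by move=> xs us; apply: tpath_rcons;
  [exact: path_rev|exact: uniq_rev]. Qed.

(** A chord would be a second simple path between its ends. *)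
Lemma straight_path x s : path (@adj G) x s -> uniq (x :: s) ->
  straight (x :: s).
Proof.
elim: s x => [//|v s IH] x /= /andP[xv vs] /andP[xN us].
split; last exact: IH.
move=> z zs; have xz : (x == z) = false.
  by apply/negP => /eqP xz; rewrite xz zs in xN.
rewrite /inter xz [z == x]eq_sym xz [adj z x]adjC.
suff -> : adj x z = (z == v) by [].
apply/idP/eqP => [xz1|-> //].
have xs : path (@adj G) x (v :: s) by rewrite /= xv.
have {}us : uniq (x :: v :: s) by rewrite /= xN.
have [s1 [s2 sE]] : exists s1 s2, v :: s = rcons s1 z ++ s2.
  by case/splitPr: zs => s1 s2; exists s1, s2; rewrite cat_rcons.
move: xs us; rewrite sE cat_path -cat_cons cat_uniq =>
  /andP[xs1 _] /andP[us1 _].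
have s1z : rcons s1 z = [:: z].
  by apply: (simple_path_uniq xs1) => //=; rewrite ?xz1 ?last_rcons // inE xz.
by move: sE; rewrite s1z => -[].
Qed.

Lemma two_neighbours v a b c : (valency v <= 2)%N -> a != b ->
  adj v a -> adj v b -> adj v c -> (c == a) || (c == b).
Proof.
move=> v2 ab va vb vc; apply/negPn; rewrite negb_or; apply/negP => /andP[ca cb].
have : ([set a; b; c] \subset [set w | adj v w])%SET.
  by apply/fintype.subsetP => w; rewrite !inE => /orP[/orP[]|] /eqP->.
move=> /subset_leq_card; rewrite -/(valency v) finset.setUC cardsU1 cards2 !inE.
by rewrite negb_or ca cb ab /= => /leq_trans /(_ v2).
Qed.

Lemma valency_gt0 v w : adj v w -> (0 < valency v)%N.
Proof. by move=> vw; apply/card_gt0P; exists w; rewrite inE. Qed.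

Lemma valency_gt1 v a b : a != b -> adj v a -> adj v b -> (1 < valency v)%N.
Proof.
move=> ab va vb; have : ([set a; b] \subset [set w | adj v w])%SET.
  by apply/fintype.subsetP => w; rewrite !inE => /orP[] /eqP->.
by move=> /subset_leq_card; rewrite cards2 ab.
Qed.

Lemma valency1_eq v a b : valency v = 1%N -> adj v a -> adj v b -> a = b.
Proof.
move=> v1 va vb; apply/eqP/negPn/negP => ab.
by have := valency_gt1 ab va vb; rewrite v1.
Qed.

(** At a vertex of valency two there is only one way to go on, and a chain
    cannot stop there. *)
Lemma chain_determined x w p q :
    path (@adj G) x (w :: p) -> uniq (x :: w :: p) ->
    path (@adj G) x (w :: q) -> uniq (x :: w :: q) ->
    ~~ has_node (belast w p) -> ~~ has_node (belast w q) ->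
    valency (last w p) != 2%N -> valency (last w q) != 2%N ->
  p = q.
Proof.
elim: p q x w => [|a p IH] [|b q] x w //=.
- move=> /andP[xw _] _ /and3P[_ wb _] /andP[xNq _] _ /norP[wN _] w2 _.
  have := @valency_gt1 w x b; rewrite wb [adj w x]adjC xw.
  rewrite !inE !negb_or in xNq; case/and3P: xNq => _ -> _ /(_ isT isT isT).
  by move: wN w2; case: (valency w) => [|[|[|]]].
- move=> /and3P[xw wa _] /andP[xNp _] _ _ /norP[wN _] _ _ w2.
  have := @valency_gt1 w x a; rewrite wa [adj w x]adjC xw.
  rewrite !inE !negb_or in xNp; case/and3P: xNp => _ -> _ /(_ isT isT isT).
  by move: wN w2; case: (valency w) => [|[|[|]]].
move=> /and3P[xw wa ap] /andP[xNp wp] /and3P[_ wb bq] /andP[xNq wq].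
move=> /norP[wN pN] /norP[_ qN] p2 q2.
have w2 : (valency w <= 2)%N by rewrite leqNgt.
rewrite !inE !negb_or in xNp xNq.
case/and3P: xNp => _ xa _; case/and3P: xNq => _ xb _.
have := two_neighbours w2 xa; rewrite [adj w x]adjC => /(_ b xw wa wb).
rewrite [b == x]eq_sym (negPf xb) /= => /eqP ba.
subst b; congr (_ :: _).
by apply: (IH q w a) => //=; rewrite ?wa ?wb.
Qed.

(** A last vertex of valency at least two has a neighbour other than its
    predecessor, and this neighbour is off the path because a tree has no
    cycles. *)
Lemma extend_to_leaf x p : p != [::] -> path (@adj G) x p -> uniq (x :: p) ->
  exists q, [/\ path (@adj G) x (p ++ q), uniq (x :: p ++ q)
              & valency (last x (p ++ q)) = 1%N].
Proof.
have [m] := ubnP (#|G| - size p)%N; elim: m p => [//|m IH] p; rewrite ltnS.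
case/lastP: p => [//|s z] sm _ xs us.
have zlast : adj z (last x s) by move: xs; rewrite rcons_path adjC => /andP[].
have [z1|z1] := eqVneq (valency z) 1%N.
  by exists [::]; rewrite cats0 last_rcons.
have [z' zz' z'N] : exists2 z', adj z z' & z' != last x s.
  have := valency_gt0 zlast; rewrite leq_eqVlt eq_sym (negPf z1) /= => z2.
  have /card_gt0P[z'] : (0 < #|[set w | adj z w] :\ last x s|)%N.
    by move: z2; rewrite /valency (cardsD1 (last x s)) inE zlast.
  by rewrite !inE => /andP[z'N zz']; exists z'.
have z'out : z' \notin x :: rcons s z.
  rewrite -rcons_cons mem_rcons inE negb_or; apply/andP; split.
    by apply/negP => /eqP z'z; rewrite z'z adjN in zz'.
  apply/negP => z's; case/splitPl: z's xs us z'N => p1 p2 lE.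
  rewrite -cats1 -catA cat_path lE last_cat lE => /andP[_ z'p2].
  rewrite -cat_cons cat_uniq => /and3P[_ up1 up2] z'N.
  (* The rest of the path and the edge from z' to z must be the same path. *)
  have : p2 ++ [:: z] = [:: z].
    apply: (@simple_path_uniq z') => //=; rewrite ?last_cat //.
    - rewrite up2 andbT; apply/negP => z'p; move/negP: up1; apply.
      by apply/hasP; exists z' => //; rewrite -lE mem_last.
    - by rewrite adjC zz'.
    - by rewrite inE andbT; apply/negP => /eqP z'z; rewrite z'z adjN in zz'.
  by case: p2 {up1 up2 z'p2} z'N => [|? [|]] //=; rewrite eqxx.
have [||||q [xq uq lq]] := IH (rcons (rcons s z) z').
- have : (size (rcons s z) < #|G|)%N 
      by rewrite -[(size (rcons s z)).+1]/(size (x :: rcons s z))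
        -(card_uniqP us) max_card.
  by rewrite !size_rcons in sm *; lia.
- by case: (rcons _ _) (size_rcons (rcons s z) z').
- by rewrite rcons_path xs last_rcons.
- by rewrite -[x :: rcons _ z']rcons_cons rcons_uniq z'out.
by exists (z' :: q); rewrite -cat_rcons.
Qed.

Definition first x e : G := head x (tpath x e).

Lemma first_rcons x e : x != e ->
  tpath x e = first x e :: behead (tpath x e).
Proof. by rewrite /first; case/interiorP => -> _ _; case: (interior x e). Qed.

Lemma adj_first x e : x != e -> adj x (first x e).
Proof.
by move=> xe; have [+ _ _] := tpathP x e; rewrite first_rcons //= => /andP[].
Qed.

Implicit Types (n : node G) (u : leaf G).

(** The vertices at which the chains issuing from n stop: treating
    neighbouring nodes and leaves together, the edges at n correspond to the
    elements of this set. *)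
Definition ends n : {set G} :=
  [set e | [&& val n != e, valency e != 2%N
             & ~~ has_node (interior (val n) e)]].

Lemma chain_end_determined x e e' : x != e -> x != e' ->
    valency e != 2%N -> valency e' != 2%N ->
    ~~ has_node (interior x e) -> ~~ has_node (interior x e') ->
  first x e = first x e' -> e = e'.
Proof.
move=> xe xe' e2 e2' eN eN' fE.
have [xs us lE] := tpathP x e; have [xs' us' lE'] := tpathP x e'.
have [tE _ _] := interiorP xe; have [tE' _ _] := interiorP xe'.
move: xs us lE xs' us' lE' tE tE'.
rewrite (first_rcons xe) (first_rcons xe') -fE !(lastI (first _ _)).
set w := first _ _; set p := behead _; set q := behead _.
move=> xs us lE xs' us' lE' /rcons_inj[sE _] /rcons_inj[sE' _].
rewrite -!lastI in xs us lE xs' us' lE'.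
have pq : p = q.
  by apply: (chain_determined xs us xs' us');
    rewrite ?sE ?sE' // [last w _](lE, lE').
by rewrite -lE -lE' /= pq.
Qed.

Lemma first_inj n : {in ends n &, injective (first (val n))}.
Proof.
move=> e e'; rewrite !inE => /and3P[ne e2 eN] /and3P[ne' e2' eN'].
exact: chain_end_determined.
Qed.

(** A path from n through w to a leaf is cut at its first vertex of valency
    other than two. *)
Lemma first_surj n w : adj (val n) w ->
  exists2 e, e \in ends n & first (val n) e = w.
Proof.
move=> nw; have [//|||q [xq uq lq]] := @extend_to_leaf (val n) [:: w].
- by rewrite /= nw.
- by rewrite /= inE andbT; apply/negP => /eqP E; rewrite -E adjN in nw.
have hs : has (fun e => valency e != 2%N) (w :: q).
  by apply/hasP; exists (last w q); rewrite ?mem_last // lq.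
move: xq uq {lq}; rewrite cat1s.
have : head (val n) (w :: q) = w by [].
case: (split_find hs) => e s r e2 sN hd.
rewrite cat_path -cat_cons cat_uniq => /andP[xs _] /andP[us _].
have [tE iE] := tpath_rcons xs us.
exists e; last by rewrite /first tE; case: (s) hd.
rewrite inE e2 iE; apply/and3P; split=> //.
  by move: us => /= /andP[+ _]; rewrite mem_rcons inE negb_or => /andP[].
by apply: contra sN; apply: sub_has => v /= v3; rewrite gtn_eqF.
Qed.

Lemma mem_nbr_nodes n n' : (n' \in nbr_nodes n) = (val n' \in ends n).
Proof.
rewrite !inE -val_eqE eq_sym; congr (_ && _).
by case: (valency _) (valP n') => [|[|[|]]].
Qed.

Lemma node_leaf_neq n u : val n != val u.
Proof.
by apply/eqP => nu; have := valP n; rewrite nu (eqP (valP u)).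
Qed.

Lemma mem_node_leaves n u : (u \in node_leaves n) = (val u \in ends n).
Proof.
rewrite !inE node_leaf_neq (eqP (valP u)) /=.
have [-> _ _] := interiorP (node_leaf_neq n u).
by rewrite /has_node has_rcons (eqP (valP u)).
Qed.

Lemma ends_terminal n e : e \in ends n ->
  (exists2 n', n' \in nbr_nodes n & e = val n')
  \/ (exists2 u, u \in node_leaves n & e = val u).
Proof.
move=> en; have := en; rewrite !inE => /and3P[ne e2 _].
have [e3|e3] := leqP 3 (valency e).
  by left; exists (Sub e e3); rewrite ?mem_nbr_nodes.
have e1 : valency e == 1%N.
  rewrite eqn_leq -ltnS ltn_neqAle e2 -ltnS e3 /=.
  have [_ xs _] := interiorP ne; apply:
    (@valency_gt0 _ (last (val n) (interior (val n) e))).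
  by move: xs; rewrite rcons_path adjC => /andP[].
by right; exists (Sub e e1); rewrite ?mem_node_leaves.
Qed.

(** Every edge at n begins exactly one chain, by [first_inj] and
    [first_surj]. *)
Lemma sum_neighbours (V : nmodType) n (F : G -> V) :
  \sum_(w | adj (val n) w) F w =
    \sum_(n' in nbr_nodes n) F (first (val n) (val n'))
    + \sum_(u in node_leaves n) F (first (val n) (val u)).
Proof.
pose Pn := val @: nbr_nodes n; pose Pu := val @: node_leaves n.
have endsE : ends n = (Pn :|: Pu)%SET.
  apply/finset.setP => e; rewrite finset.in_setU;
    apply/idP/orP => [/ends_terminal[]|].
  - by case=> n' n'n ->; left; apply: imset_f.
  - by case=> u un ->; right; apply: imset_f.
  by case=> /imsetP[z zn ->]; rewrite -?mem_nbr_nodes -?mem_node_leaves.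
have dis : [disjoint Pn & Pu].
  rewrite -finset.setI_eq0; apply/eqP/finset.setP => e; rewrite !inE;
    apply/negP.
  case/andP=> /imsetP[n' _ ->] /imsetP[u _] nu.
  by have := node_leaf_neq n' u; rewrite nu eqxx.
transitivity (\sum_(w in first (val n) @: ends n) F w).
  apply: eq_bigl => w; apply/idP/imsetP => [/first_surj[e en <-]|[e en ->]].
    by exists e.
  by apply: adj_first; move: en; rewrite inE => /and3P[].
rewrite big_imset /=; last exact: first_inj.
rewrite endsE (eq_bigl [predU Pn & Pu]) => [|e]; last by rewrite !inE.
rewrite bigU //= /Pn /Pu.
by rewrite !big_imset //; apply: in2W; exact: val_inj.
Qed.

Lemma valency_node n : valency (val n) = (delta_nodes n + #|node_leaves n|)%N.
Proof.
rewrite /delta_nodes -!sum1_card /valency cardsE -sum1_card.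
exact: (sum_neighbours n (fun=> 1%N)).
Qed.

Lemma first_node_on x (m : node G) : x != val m ->
  exists n, x != val n /\ ~~ has_node (interior x (val n)).
Proof.
case/interiorP=> _; set s := interior _ _ => xs us.
have hs : has (fun w => 3 <= valency w)%N (rcons s (val m)).
  by rewrite has_rcons (valP m).
move: xs us; case: (split_find hs) => e t r e3 tN.
rewrite cat_path -cat_cons cat_uniq => /andP[xt _] /andP[ut _].
exists (Sub e e3); have [tE iE] := tpath_rcons xt ut; rewrite iE; split=> //.
by move: ut => /= /andP[+ _]; rewrite mem_rcons inE negb_or => /andP[].
Qed.

Lemma nbr_nodes_gt0 n : (1 < #|node G|)%N -> (0 < delta_nodes n)%N.
Proof.
move=> n1; have /card_gt0P[m] : (0 < #|[set~ n]|)%N by rewrite cardsC1; lia.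
rewrite !inE -val_eqE eq_sym => /first_node_on[n' [n'n n'N]].
by apply/card_gt0P; exists n'; rewrite !inE -val_eqE eq_sym n'n.
Qed.

(** The node is the first one on a path from u; it is unique since a leaf has
    a single neighbour and chains are determined by their first step. *)
Lemma leaf_node u : (0 < #|node G|)%N ->
  exists n, forall n', (u \in node_leaves n') = (n' == n).
Proof.
case/card_gt0P=> m _; have := node_leaf_neq m u; rewrite eq_sym.
case/first_node_on=> n [un nN]; exists n => n'.
have memE n1 : (u \in node_leaves n1) = ~~ has_node (interior (val u) (val n1)).
  have nu := node_leaf_neq n1 u; rewrite mem_node_leaves !inE nu
    (eqP (valP u)) /=.
  have [_ xs us] := interiorP nu; have [_ ->] := tpath_rev xs us.
  by rewrite /has_node has_rev.
apply/idP/eqP => [n'N|->]; last by rewrite memE.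
apply: val_inj.
have un' : val u != val n' by rewrite eq_sym node_leaf_neq.
have node2 m1 : valency (val (m1 : node G)) != 2%N.
  by case: (valency _) (valP m1) => [|[|[|]]].
rewrite memE in n'N.
apply: (chain_end_determined un' un (node2 _) (node2 _) n'N nN).
exact: valency1_eq (eqP (valP u)) (adj_first un') (adj_first un).
Qed.

End TreePaths.

(** * The intersection form along chains *)

Section ChainEquations.
Variable G : plumbing.
Hypothesis treeG : is_tree G.
Implicit Types (v w x e : G) (s : seq G) (n : node G) (u : leaf G).

Lemma chain_pred_succ x s1 v s2 e :
    path (@adj G) x (rcons (s1 ++ v :: s2) e) ->
    uniq (x :: rcons (s1 ++ v :: s2) e) ->
  [/\ adj v (last x s1), adj v (head e s2) & last x s1 != head e s2].
Proof.
rewrite rcons_cat rcons_cons cat_path -cat_cons cat_uniq.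
move=> /andP[_ /= /andP[xv vP]] /and3P[_ + _].
rewrite /= negb_or => /andP[_ /hasPn dis]; split.
- by rewrite adjC.
- by case: s2 vP {dis} => [|w s2] /= /andP[].
apply/negP => /eqP E; have := dis (head e s2).
rewrite -{2}E /= mem_last; case: s2 {vP dis E} => [|w s2] /=;
  by rewrite inE eqxx => /(_ isT).
Qed.

Lemma interior_valency x s e : path (@adj G) x (rcons s e) ->
  uniq (x :: rcons s e) -> forall v, v \in s -> (1 < valency v)%N.
Proof.
move=> xs us v vs; case/splitPr: vs xs us => s1 s2 xs us.
by have [va vb ab] := chain_pred_succ xs us; apply: (valency_gt1 ab).
Qed.

(** An interior vertex of a chain has valency two, so its predecessor and
    successor are its only neighbours. *)
Lemma chain_adj_node x s e v w : path (@adj G) x (rcons s e) ->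
    uniq (x :: rcons s e) -> ~~ has_node s -> v \in s ->
    (3 <= valency w)%N -> adj w v ->
  (w = x /\ v = head x s) \/ (w = e /\ v = last e s).
Proof.
move=> xs us sN vs w3 wv; move: xs us sN.
case/splitPr: vs => s1 s2 xs us.
rewrite /has_node has_cat /= !negb_or -leqNgt => /and3P[/hasPn N1 v2 /hasPn N2].
have [va vb ab] := chain_pred_succ xs us.
have vw : adj v w by rewrite adjC.
case/orP: (two_neighbours v2 ab va vb vw) => /eqP wE; subst w; [left|right].
  case/lastP: s1 {xs us va vb ab vw} N1 w3 wv => [//|t z] N1.
  by rewrite last_rcons => z3; have := N1 z;
    rewrite mem_rcons mem_head z3 => /(_ isT).
case: s2 {xs us va vb ab vw} N2 w3 wv => [|z s2] N2 /= z3.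
  by rewrite last_cat.
by have := N2 z; rewrite mem_head z3 => /(_ isT).
Qed.

Lemma sum_two_neighbours (V : nmodType) (F : G -> V) v a b :
    (valency v <= 2)%N -> a != b -> adj v a -> adj v b ->
  \sum_(w | adj v w) F w = F a + F b.
Proof.
move=> v2 ab va vb; rewrite (bigD1 a) //= (bigD1 b) ?vb 1?eq_sym //=.
rewrite big1 ?addr0 // => w /andP[/andP[vw wa] wb].
by have := two_neighbours v2 ab va vb vw; rewrite (negPf wa) (negPf wb).
Qed.

Variable y : G -> rat.

(** Minus the intersection matrix, applied to y. *)
Definition neg_inter_op v : rat :=
  - (euler v)%:~R * y v - \sum_(w | adj v w) y w.

(** The inhomogeneous term r at the first vertex goes into the boundary value
    there. *)
Lemma chain_rec_graph x s e (r : rat) : path (@adj G) x (rcons s e) ->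
    uniq (x :: rcons s e) -> ~~ has_node s ->
    (forall v, v \in s -> neg_inter_op v = r *+ (v == head x s)) ->
  chain_rec y (y x + r) s (y e).
Proof.
elim: s x r => [//|v s IH] x r xs us /norP[vN sN] opE; split.
  have [va vb ab] := @chain_pred_succ x [::] v s e xs us.
  have v2 : (valency v <= 2)%N by rewrite leqNgt.
  have /= := opE v (mem_head _ _).
  rewrite /neg_inter_op eqxx mulr1n (sum_two_neighbours y v2 ab va vb) /= =>
    /eqP.
  rewrite subr_eq => /eqP ->.
  have -> : chain_next y s (y e) = y (head e s) by case: (s).
  ring.
rewrite -[y v]addr0; apply: IH => //.
- by move: xs => /= /andP[].
- by move: us => /= /andP[].
move=> w ws; rewrite opE ?inE ?ws ?orbT //=.
have -> : (w == v) = false.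
  move: us; rewrite /= mem_rcons inE => /and3P[_ + _] /=.
  by rewrite negb_or => /andP[_]; case: eqVneq ws => // -> ->.
by rewrite mul0rn mulr0n.
Qed.

Lemma interior_has_node n (z : G) : z \in ends n ->
  ~~ has_node (interior (val n) z).
Proof. by rewrite inE => /and3P[]. Qed.

Lemma ends_neq n (z : G) : z \in ends n -> val n != z.
Proof. by rewrite inE => /and3P[]. Qed.

Lemma omegaE n n' : n' \in nbr_nodes n ->
  omega n n' = continuant_tail (interior (val n) (val n')).
Proof.
rewrite mem_nbr_nodes // => n'n.
have [_ xs us] := interiorP treeG (ends_neq n'n); rewrite /omega.
move: xs us; case: (interior _ _) => //= v s /andP[_ xs] /andP[_ us].
rewrite rcons_path in xs; rewrite rcons_uniq in us.
case/andP: xs => xs _; case/and3P: us => vN _ us.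
have us' : uniq (v :: s) by rewrite /= us andbT; move: vN;
  rewrite mem_rcons inE negb_or => /andP[].
have [_ ss] := straight_path treeG xs us'.
by rewrite det_sub_continuant //.
Qed.

Lemma alphaE n n' : n' \in nbr_nodes n ->
  alpha n n' = continuant (interior (val n) (val n')).
Proof.
rewrite mem_nbr_nodes // => n'n.
have [_ xs us] := interiorP treeG (ends_neq n'n); rewrite /alpha.
rewrite rcons_path in xs; rewrite -rcons_cons rcons_uniq in us.
case/andP: xs => xs _; case/andP: us => _ us.
have [_ ss] := straight_path treeG xs us.
by rewrite det_sub_continuant //; case/andP: us.
Qed.

Lemma alpha_leafE n u : u \in node_leaves n ->
  alpha_leaf n u = continuant (tpath (val n) (val u)).
Proof.
move=> _; have [xs us _] := tpathP treeG (val n) (val u).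
by rewrite /alpha_leaf det_sub_continuant //; case: (straight_path treeG xs us);
  case/andP: us.
Qed.

Lemma omega_leafE n u : u \in node_leaves n ->
  omega_leaf n u = continuant_tail (tpath (val n) (val u)).
Proof.
rewrite mem_node_leaves // => un; have ne := ends_neq un.
have [xs us _] := tpathP treeG (val n) (val u).
have [_ ss] := straight_path treeG xs us; case/andP: us => _ us.
move: us ss; rewrite /omega_leaf (first_rcons treeG ne) => /=
  /andP[_ us] [_ ss].
by rewrite det_sub_continuant.
Qed.

Lemma nbr_nodes_sym n n' : (n' \in nbr_nodes n) = (n \in nbr_nodes n').
Proof.
rewrite !inE eq_sym; case: eqVneq => //= nn'; congr (~~ _).
have ne : val n != val n' by [].
have [_ xs us] := interiorP treeG ne; have [_ ->] := tpath_rev treeG xs us.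
by rewrite /has_node has_rev.
Qed.

Lemma interior_sym n n' : n' \in nbr_nodes n ->
  interior (val n') (val n) = rev (interior (val n) (val n')).
Proof.
rewrite mem_nbr_nodes // => /ends_neq ne.
by have [_ xs us] := interiorP treeG ne; have [_ ->] := tpath_rev treeG xs us.
Qed.

Lemma alpha_sym n n' : n' \in nbr_nodes n -> alpha n' n = alpha n n'.
Proof.
move=> /interior_sym; rewrite /alpha => ->; congr det_sub.
by apply/finset.setP => v; rewrite !inE mem_rev.
Qed.

Lemma alpha_gt0 n n' : minimal G -> n' \in nbr_nodes n -> 0 < alpha n n'.
Proof.
move=> minG n'n; rewrite alphaE //.
have [|c0 ?] := andP (@continuant_growth G (interior (val n) (val n')) _).
  move=> v vs; apply: minG; rewrite leqNgt.
  by move: n'n; rewrite inE => /andP[_ /hasPn]; apply.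
exact: le_lt_trans c0 _.
Qed.

Lemma alpha_leaf_gt0 n u : minimal G -> u \in node_leaves n ->
  0 < alpha_leaf n u.
Proof.
move=> minG un; rewrite alpha_leafE //.
have [|c0 ?] := andP (@continuant_growth G (tpath (val n) (val u)) _).
  move=> v vs; apply: minG; rewrite leqNgt.
  by move: un; rewrite inE => /hasPn; apply.
exact: le_lt_trans c0 _.
Qed.

(** The value of the operator at the leaf plays the role of a boundary value
    behind the leaf. *)
Lemma leaf_chain n u : u \in node_leaves n ->
    (forall v, v \in interior (val n) (val u) -> neg_inter_op v = 0) ->
  (alpha_leaf n u)%:~R * y (first (val n) (val u))
    = (omega_leaf n u)%:~R * y (val n) + neg_inter_op (val u).
Proof.
move=> un op0; rewrite alpha_leafE // omega_leafE //.
have uE := un; rewrite mem_node_leaves // in uE; have ne := ends_neq uE.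
have [tE xs us] := interiorP treeG ne.
have cr : chain_rec y (y (val n)) (tpath (val n) (val u))
  (neg_inter_op (val u)).
  rewrite tE; apply/chain_rec_rcons; split.
    rewrite -[y (val n)]addr0; apply: chain_rec_graph => //;
      first exact: interior_has_node.
    by move=> v vs; rewrite op0 // mul0rn.
  rewrite /neg_inter_op (bigD1 (last (val n) (interior (val n) (val u)))) /=;
    last first.
    by move: xs; rewrite rcons_path adjC // => /andP[].
  rewrite big1 ?addr0 => [|w /andP[uw wN]]; first by rewrite last_map; ring.
  have := valency1_eq (eqP (valP u)) uw.
  move: xs; rewrite rcons_path [adj _ (val u)]adjC // =>
    /andP[_ ul] /(_ _ ul) wE.
  by rewrite wE eqxx in wN.
by rewrite -(chain_rec_solve cr) (first_rcons treeG ne).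
Qed.

(** The second equality is the solution of the reversed chain, where the
    inhomogeneous term sits at the far end. If the chain is empty, the first
    vertex seen from n' is n itself, without the term r that belongs to the
    boundary value; this accounts for the correction. *)
Lemma node_chain n n' (r : rat) : n' \in nbr_nodes n ->
    (forall v, v \in interior (val n) (val n') ->
       neg_inter_op v = r *+ (v == first (val n) (val n'))) ->
  [/\ (alpha n n')%:~R * y (first (val n) (val n'))
       = (omega n n')%:~R * (y (val n) + r) + y (val n'),
      (alpha n n')%:~R * (y (first (val n') (val n))
                          + r *+ nilp (interior (val n) (val n')))
       = (omega n' n)%:~R * y (val n') + (y (val n) + r)
    & y (val n') \is a Num.int -> y (first (val n') (val n)) \is a Num.int ->
      y (first (val n) (val n')) \is a Num.int].
Proof.
move=> n'n opE; have n'E := n'n; rewrite mem_nbr_nodes // in n'E.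
have ne := ends_neq n'E; have [tE xs us] := interiorP treeG ne.
have ne' : val n' != val n by rewrite eq_sym.
have [tE' _ _] := interiorP treeG ne'.
have firstE : first (val n) (val n') =
  head (val n') (interior (val n) (val n')).
  by rewrite /first tE; case: (interior _ _).
have firstE' : first (val n') (val n) =
  last (val n) (interior (val n) (val n')).
  rewrite /first tE' interior_sym //.
  by case/lastP: (interior _ _) => //= s z; rewrite rev_rcons last_rcons.
have cr : chain_rec y (y (val n) + r) (interior (val n) (val n')) (y (val n')).
  apply: chain_rec_graph => //; first exact: interior_has_node.
  by move=> v vs; rewrite opE // firstE; case: (interior _ _) vs.
have cr' := chain_rec_rev cr; split.
- rewrite alphaE // omegaE // -(chain_rec_solve cr) firstE.
  by case: (interior _ _).
- have nn' : n \in nbr_nodes n' by rewrite -nbr_nodes_sym.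
  rewrite -alpha_sym // alphaE // omegaE //.
  rewrite interior_sym // -(chain_rec_solve cr') firstE'; congr (_ * _).
  case/lastP: (interior _ _) => //= s z; rewrite rev_rcons last_rcons /=.
  by rewrite /nilp size_rcons /= addr0.
move=> yn' yl; have [s0|s0] := eqVneq (interior (val n) (val n')) [::].
  by rewrite firstE s0.
apply: (chain_rec_int cr' yn').
  rewrite firstE' in yl; case/lastP: (interior _ _) s0 yl => // s z _.
  by rewrite rev_rcons last_rcons.
by rewrite mem_rev firstE; case: (interior _ _) s0 => //= v s _;
  exact: mem_head.
Qed.

End ChainEquations.

(** * Coordinates in the dual basis *)

(** Solvability follows from uniqueness because the matrix is square. *)
Lemma ffun_dual_system (I : finType) (c : I -> I -> rat) :
    (forall y : {ffun I -> rat},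
       (forall j, \sum_i y i * c i j = 0) -> y = 0) ->
  forall t : I -> rat,
    exists y : {ffun I -> rat}, forall j, \sum_i y i * c i j = t j.
Proof.
move=> inj t.
pose M : 'M[rat]_#|I| := \matrix_(i, j) c (enum_val i) (enum_val j).
have mulE (r : 'rV[rat]_#|I|) (j : I) :
    (r *m M) 0 (enum_rank j) = \sum_i [ffun k => r 0 (enum_rank k)] i * c i j.
  rewrite mxE (reindex (@enum_rank I)) /=; last first.
    by apply: onW_bij; apply: enum_rank_bij.
  by apply: eq_bigr => i _; rewrite mxE !enum_rankK ffunE.
have uM : M \in unitmx.
  rewrite -row_free_unit -kermx_eq0; apply/eqP/row_matrixP => i.
  rewrite row0; set r := row i _.
  have rM : r *m M = 0 by rewrite -row_mul mulmx_ker row0.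
  have /ffunP r0 : [ffun k => r 0 (enum_rank k)] = 0 :> {ffun I -> rat}.
    by apply: inj => j; rewrite -mulE rM mxE.
  by apply/rowP => j; have := r0 (enum_val j); rewrite !ffunE enum_valK => ->;
    rewrite mxE.
exists [ffun k => ((\row_j t (enum_val j)) *m invmx M) 0 (enum_rank k)] => j.
by rewrite -mulE -mulmxA mulVmx // mulmx1 mxE enum_rankK.
Qed.

Section DualCoordinates.
Variable G : plumbing.
Hypothesis treeG : is_tree G.
Hypothesis nd : negative_definite G.
Local Notation QL := {ffun G -> rat}.
Implicit Types (x y : QL) (v w : G) (n : node G) (u : leaf G).

(** The coordinate of x on E*_v, in view of [dcoord_Estar] and
    [dcoord_inj]. *)
Definition dcoord v x : rat := - Defs.form x (Evec v).

Lemma dcoord_inter x v : dcoord v x = neg_inter_op x v.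
Proof.
rewrite /dcoord form_Evec (bigD1 v) //=
  /inter eqxx opprD /neg_inter_op mulNr mulrC.
congr (_ + _); rewrite -!sumrN [RHS]big_mkcond [RHS](bigD1 v) //=
  (adjN treeG) add0r.
apply: eq_bigr => w wv; rewrite (negPf wv) (adjC treeG).
by case: adj; rewrite ?mulr1 ?mulr0 ?oppr0.
Qed.

Lemma dcoord_is_zmod v : zmod_morphism (dcoord v).
Proof.
move=> x y; rewrite /dcoord !form_Evec -opprD -sumrB; congr (- _).
by apply: eq_bigr => w _; rewrite !ffunE; ring.
Qed.

HB.instance Definition _ v :=
  GRing.isZmodMorphism.Build QL rat (dcoord v) (dcoord_is_zmod v).

Lemma dcoordZ q x v : dcoord v (scaleQ q x) = q * dcoord v x.
Proof.
rewrite /dcoord !form_Evec mulrN mulr_sumr; congr (- _).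
by apply: eq_bigr => w _; rewrite ffunE mulrA.
Qed.

Lemma dcoord_Estar v w : dcoord w (Estar v) = (v == w)%:R.
Proof. by rewrite /dcoord form_Estar // opprK. Qed.

Lemma form_dcoord x y : Defs.form x y = - \sum_v dcoord v x * y v.
Proof.
rewrite /Defs.form exchange_big /= -sumrN; apply: eq_bigr => w _.
by rewrite -mulr_suml -form_Evec /dcoord mulNr opprK.
Qed.

(** A negative definite form is nondegenerate. *)
Lemma dcoord_inj x y : (forall v, dcoord v x = dcoord v y) -> x = y.
Proof.
move=> E; apply/eqP; rewrite -subr_eq0; apply/negPn/negP => /nd.
rewrite form_dcoord big1 ?oppr0 ?ltxx // => v _.
by rewrite (raddfB (dcoord v)) /= E subrr mul0r.
Qed.

Lemma dualL_dcoord x : (forall v, dcoord v x \is a Num.int) -> dualL x.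
Proof.
move=> xZ y /forallP yZ; rewrite form_dcoord rpredN rpred_sum // => v _.
exact: rpredM.
Qed.

Lemma dcoord_int x v : x \in latL G -> dcoord v x \is a Num.int.
Proof.
move=> /forallP xZ; rewrite dcoord_inter /neg_inter_op.
by rewrite rpredB ?rpredM ?rpredN ?intr_int ?rpred_sum.
Qed.

Lemma class_eq x y : class x = class y <-> x - y \in latL G.
Proof. by rewrite /class Quotient.idealrBE; split=> /eqP. Qed.

Lemma class_is_zmod : zmod_morphism (@class G).
Proof. by move=> x y; rewrite /class raddfB. Qed.

HB.instance Definition _ :=
  GRing.isZmodMorphism.Build QL (QLmodL G) (@class G) class_is_zmod.

Definition Estar_comb (p : node G -> rat) (q : leaf G -> rat) : QL :=
  \sum_n scaleQ (p n) (Estar (val n)) + \sum_u scaleQ (q u) (Estar (val u)).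

Lemma Estar_mulrz v (m : int) : Estar v *~ m = scaleQ m%:~R (Estar v).
Proof.
apply: dcoord_inj => w; rewrite dcoordZ dcoord_Estar (raddfMz (dcoord w)) /=
  dcoord_Estar.
by rewrite -mulrzl.
Qed.

Lemma dcoord_Estar_comb p q v : dcoord v (Estar_comb p q) =
  \sum_n p n *+ (val n == v) + \sum_u q u *+ (val u == v).
Proof.
rewrite (raddfD (dcoord v)) !(raddf_sum (dcoord v)) /=.
by congr (_ + _); apply: eq_bigr => z _; rewrite dcoordZ dcoord_Estar mulr_natr.
Qed.

Lemma dcoord_Estar_comb_node p q n : dcoord (val n) (Estar_comb p q) = p n.
Proof.
rewrite dcoord_Estar_comb (bigD1 n) //= eqxx big1 => [|m /negPf mn]; last first.
  by rewrite val_eqE mn.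
rewrite big1 ?addr0 // => u _.
by rewrite eq_sym (negPf (node_leaf_neq n u)).
Qed.

Lemma dcoord_Estar_comb_leaf p q u : dcoord (val u) (Estar_comb p q) = q u.
Proof.
rewrite dcoord_Estar_comb addrC (bigD1 u) //= eqxx big1 => [|m /negPf mn];
  last first.
  by rewrite val_eqE mn.
rewrite big1 ?addr0 // => n _.
by rewrite (negPf (node_leaf_neq n u)).
Qed.

(** In a tree with a node no vertex is isolated, so these are the vertices of
    valency two. *)
Definition inner v := (valency v <= 2)%N && (valency v != 1%N).

Lemma vertexP v : [\/ exists n, v = val n, exists u, v = val u | inner v].
Proof.
have [v3|v3] := leqP 3 (valency v); first by constructor 1; exists (Sub v v3).
have [v1|v1] := eqVneq (valency v) 1%N; last by constructor 3;
  rewrite /inner v1 -ltnS v3.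
by constructor 2; exists (Sub v (introT eqP v1)).
Qed.

Lemma inner_node n : inner (val n) = false.
Proof. by rewrite /inner leqNgt (valP n). Qed.

Lemma inner_leaf u : inner (val u) = false.
Proof. by rewrite /inner (eqP (valP u)). Qed.

Lemma dcoord_Estar_comb_inner p q v : inner v -> dcoord v (Estar_comb p q) = 0.
Proof.
move=> iv; rewrite dcoord_Estar_comb !big1 ?addr0 // => z _;
  case: eqVneq => // zv.
  by rewrite -zv inner_leaf in iv.
by rewrite -zv inner_node in iv.
Qed.

(** As many equations as unknowns; a solution y for zero data has, at each
    vertex v, either y_v = 0 or (y, E_v) = 0, so (y, y) = 0 and y = 0. *)
Lemma dcoord_extension (l : node G -> rat) (t : G -> rat) : exists y : QL,
  (forall n, y (val n) = l n) /\
  (forall v, (valency v <= 2)%N -> dcoord v y = t v).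
Proof.
(* Column w of c reads off y_w at a node w, the dual coordinate elsewhere. *)
pose c v w : rat :=
  if (2 < valency w)%N then (v == w)%:R else - (inter v w)%:~R.
have cE (y : QL) w : \sum_v y v * c v w =
  if (2 < valency w)%N then y w else dcoord w y.
  rewrite /c; case: ifP => _.
    by rewrite (bigD1 w) //= eqxx mulr1 big1 ?addr0 // => v /negPf->;
      rewrite mulr0.
  by rewrite /dcoord form_Evec -sumrN; apply: eq_bigr => v _; rewrite mulrN.
pose t' w := if insub w is Some n then l n else t w.
have [|y yE] := @ffun_dual_system G c _ t'.
  move=> y y0; apply/eqP/negPn/negP => /nd;
    rewrite form_dcoord big1 ?oppr0 ?ltxx // => v _.
  by have := y0 v; rewrite cE; case: ifP => _ ->; rewrite ?mulr0 ?mul0r.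
exists y; split=> [n|v v2]; first by have := yE (val n);
  rewrite cE (valP n) /t' valK.
by have := yE v; rewrite cE ltnNge v2 /t' insubN // -leqNgt.
Qed.

(** A path from a node meets only integral values: after a node comes the
    first vertex of a chain, and after a vertex of valency two the dual
    coordinate there expresses the next value through the two preceding
    ones. *)
Lemma latL_of_nodes (y : QL) (n0 : node G) :
    (forall n, y (val n) \is a Num.int) ->
    (forall n (e : G), e \in ends n -> y (first (val n) e) \is a Num.int) ->
    (forall v, (valency v <= 2)%N -> dcoord v y \is a Num.int) ->
  y \in latL G.
Proof.
move=> yN yF yK; apply/forallP => v.
(* x0 is the vertex before x on the path; the first vertex is a node. *)
suff walk p (x x0 : G) : y x \is a Num.int -> path (@adj G) x p ->
  uniq (x :: p) ->
    (2 < valency x)%N \/ [/\ y x0 \is a Num.int, adj x x0 & x0 \notin p] ->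
    y (last x p) \is a Num.int.
  have [xp up <-] := tpathP treeG (val n0) v.
  by apply: (walk _ _ (val n0)); rewrite ?yN ?(valP n0) //; left.
elim: p x x0 => [//|w p IH] x x0 yx /= /andP[xw wp] /andP[xN up] x0P.
apply: (IH w x) => //; last first.
  by right; rewrite adjC //; split=> //; move: xN;
    rewrite inE negb_or => /andP[].
have [x3|x2] := leqP 3 (valency x).
  have [e en <-] := first_surj treeG (n := Sub x x3) xw.
  exact: (yF (Sub x x3)).
case: x0P => [|[yx0 xx0 x0N]]; first by rewrite ltnNge -ltnS x2.
have x0w : x0 != w by move: x0N; rewrite inE negb_or => /andP[].
have := yK x x2; rewrite dcoord_inter /neg_inter_op
  (sum_two_neighbours y x2 x0w) //= => K.
have -> : y w = - (euler x)%:~R * y x - y x0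
               - (- (euler x)%:~R * y x - (y x0 + y w)) by ring.
by rewrite rpredB // rpredB // rpredM ?rpredN ?intr_int.
Qed.

End DualCoordinates.

(** * Dual coordinates of a reduced lift *)

Section ReducedLift.
Variable G : plumbing.
Hypothesis treeG : is_tree G.
Hypothesis nd : negative_definite G.
Hypothesis minG : minimal G.
Variable lt : rel (node G).
Hypothesis ltO : is_orientation lt.
Variable a : lift_coef G.
Local Notation QL := {ffun G -> rat}.
Local Notation ZN := {ffun node G -> int}.
Implicit Types (x y : QL) (v w : G) (n m : node G) (u : leaf G).

(** The part of the coefficient of E*_v in a that is due to the chains between
    nodes. A node v receives such a part from the empty chains that end in
    it. *)
Definition first_coef v : int :=
  \sum_n \sum_(n' in nbr_nodes n | lt n n')
     lift_first a n n' *+ (first (val n) (val n') == v).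

Lemma dcoord_lift v : dcoord v (lift_vec lt a) =
  \sum_n (lift_node a n)%:~R *+ (val n == v)
  + \sum_u (lift_leaf a u)%:~R *+ (val u == v) + (first_coef v)%:~R.
Proof.
have E (z : G) (k : int) : dcoord v (Estar z *~ k) = k%:~R *+ (z == v).
  by rewrite Estar_mulrz // dcoordZ dcoord_Estar // mulr_natr.
rewrite !(raddfD (dcoord v)) !(raddf_sum (dcoord v)) /=.
congr (_ + _ + _); try by apply: eq_bigr => z _; rewrite E.
rewrite rmorph_sum; apply: eq_bigr => n _ /=.
rewrite (raddf_sum (dcoord v)) rmorph_sum; apply: eq_bigr => n' _ /=.
by rewrite E rmorphMn.
Qed.

Lemma dcoord_lift_node n : dcoord (val n) (lift_vec lt a) =
  (lift_node a n)%:~R + (first_coef (val n))%:~R.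
Proof.
rewrite dcoord_lift (bigD1 n) //= eqxx big1 ?addr0 => [|m /negPf mn];
  last first.
  by rewrite val_eqE mn.
rewrite big1 ?addr0 // => u _.
by rewrite eq_sym (negPf (node_leaf_neq n u)).
Qed.

Lemma orient_asym n n' : n' \in nbr_nodes n -> lt n n' -> lt n' n = false.
Proof. by move=> /ltO + l; rewrite l addTb => /negPf. Qed.

Lemma first_interior n n' : n' \in nbr_nodes n ->
    (valency (first (val n) (val n')) <= 2)%N ->
  first (val n) (val n') \in interior (val n) (val n').
Proof.
rewrite mem_nbr_nodes // => /ends_neq ne; have [tE _ _] := interiorP treeG ne.
rewrite /first tE; case: (interior _ _) => [|v s] /=; last by rewrite mem_head.
by rewrite leqNgt (valP n').
Qed.

Lemma first_valency n n' : n' \in nbr_nodes n ->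
    (valency (first (val n) (val n')) <= 2)%N ->
  (1 < valency (first (val n) (val n')))%N.
Proof.
move=> n'n v2; have := first_interior n'n v2.
rewrite mem_nbr_nodes // in n'n; have [_ xs us] :=
  interiorP treeG (ends_neq n'n).
exact: (interior_valency treeG xs us).
Qed.

Lemma interior_le2 n (e v : G) : e \in ends n -> v \in interior (val n) e ->
  (valency v <= 2)%N.
Proof. by move=> /interior_has_node /hasPn + vs => /(_ v vs);
  rewrite -leqNgt. Qed.

(** The node m is adjacent to an interior vertex of the chain from n to e,
    hence is n or e; the direction is then determined by the first vertex. *)
Lemma first_in_chain n (e : G) m m' : e \in ends n -> m' \in nbr_nodes m ->
    first (val m) (val m') \in interior (val n) e ->
  (m = n /\ val m' = e) \/ (val m = e /\ m' = n).
Proof.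
move=> en m'm vs; have [_ xs us] := interiorP treeG (ends_neq en).
have v2 := interior_le2 en vs.
have mE := m'm; rewrite mem_nbr_nodes // in mE.
have mv := adj_first treeG (ends_neq mE).
have hE : head (val n) (interior (val n) e) = first (val n) e.
  have [tE _ _] := interiorP treeG (ends_neq en); rewrite /first tE.
  by case: (interior _ _) vs.
have [[mn vE]|[me vE]] := chain_adj_node treeG xs us (interior_has_node en) vs
  (valP m) mv.
  left; have {}mn := val_inj mn; subst m; split=> //.
  by apply: (first_inj treeG mE en); rewrite vE hE.
right; split=> //; subst e.
have mn : m \in nbr_nodes n by rewrite mem_nbr_nodes.
have nm : n \in nbr_nodes m by rewrite -nbr_nodes_sym.
have nE := nm; rewrite mem_nbr_nodes // in nE.
apply: val_inj; apply: (first_inj treeG mE nE); rewrite vE.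
have [tE _ _] := interiorP treeG (ends_neq nE); rewrite /first tE.
rewrite (interior_sym treeG mn).
by case/lastP: (interior _ _) vs => [//|s z _]; rewrite rev_rcons last_rcons.
Qed.

Lemma first_coef_leaf u : first_coef (val u) = 0.
Proof.
rewrite /first_coef big1 // => n _; rewrite big1 // => n' /andP[n'n _].
case: eqP => // vE; have := first_valency n'n.
by rewrite vE (eqP (valP u)) => /(_ isT).
Qed.

Lemma first_coef_leaf_chain n u v : u \in node_leaves n ->
  v \in interior (val n) (val u) -> first_coef v = 0.
Proof.
rewrite mem_node_leaves // => un vs; rewrite /first_coef big1 // => m _.
rewrite big1 // => m' /andP[m'm _]; case: eqP => // vE; rewrite -vE in vs.
by have [[_ E]|[E _]] := first_in_chain un m'm vs;
  [have := node_leaf_neq m' u|have := node_leaf_neq m u]; rewrite E eqxx.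
Qed.

(** The only other chain with first vertex v could be the reversed one, which
    has the wrong orientation. *)
Lemma first_coef_chain n n' v : n' \in nbr_nodes n -> lt n n' ->
    v \in interior (val n) (val n') ->
  first_coef v = lift_first a n n' *+ (v == first (val n) (val n')).
Proof.
move=> n'n l vs; have nE := n'n; rewrite mem_nbr_nodes // in nE.
have zero m m' : m' \in nbr_nodes m -> lt m m' -> (m, m') != (n, n') ->
    lift_first a m m' *+ (first (val m) (val m') == v) = 0.
  move=> m'm lm; case: (first _ _ =P v) => // vE; rewrite -vE in vs.
  have [[-> /val_inj ->]|[/val_inj mE m'E]] := first_in_chain nE m'm vs.
    by rewrite eqxx.
  by subst m m'; rewrite (orient_asym n'n l) in lm.
rewrite /first_coef (bigD1 n) //= (bigD1 n') ?n'n //= eq_sym.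
rewrite [X in _ + X + _]big1 => [|m' /andP[/andP[m'm lm] mN]]; last first.
  by apply: zero => //; rewrite xpair_eqE negb_and mN orbT.
rewrite big1 ?addr0 // => m mN; rewrite big1 // => m' /andP[m'm lm].
by apply: zero => //; rewrite xpair_eqE negb_and mN.
Qed.

(** Interior vertices of a chain are not nodes. *)
Lemma first_eq_node m m' n : m' \in nbr_nodes m ->
  first (val m) (val m') = val n -> m' = n /\ interior (val m) (val m') = [::].
Proof.
move=> m'm; have mE := m'm; rewrite mem_nbr_nodes // in mE.
have [tE _ _] := interiorP treeG (ends_neq mE).
rewrite /first tE; case E: (interior _ _) => [|v s] /= vE;
  first by rewrite (val_inj vE).
have := @interior_le2 _ _ v mE; rewrite E mem_head vE leqNgt (valP n).
by move=> /(_ isT).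
Qed.

Lemma first_coef_node n : first_coef (val n) =
  \sum_(m in nbr_nodes n | lt m n)
    lift_first a m n *+ nilp (interior (val n) (val m)).
Proof.
rewrite /first_coef [RHS]big_mkcond; apply: eq_bigr => m _ /=.
have [nm|nm] := boolP (m \in nbr_nodes n); last first.
  rewrite big1 // => m' /andP[m'm _]; case: eqP => // /(first_eq_node m'm)[E _].
  by rewrite nbr_nodes_sym // -E m'm in nm.
have mn : n \in nbr_nodes m by rewrite nbr_nodes_sym.
have [lmn|lmn] := boolP (lt m n) => /=; last first.
  rewrite big1 // => m' /andP[m'm lm];
    case: eqP => // /(first_eq_node m'm)[E _].
  by rewrite E (negPf lmn) in lm.
rewrite (bigD1 n) ?mn //= big1 ?addr0 => [|m' /andP[/andP[m'm lm] m'N]];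
  last first.
  case: eqP => // /(first_eq_node m'm)[E _].
  by rewrite E eqxx in m'N.
congr (_ *+ _); have mE := mn; rewrite mem_nbr_nodes // in mE.
rewrite (interior_sym treeG mn) /nilp size_rev.
case: eqP => [/(first_eq_node mn)[_ ->] //|]; case E: (interior _ _) => [|//].
have [tE _ _] := interiorP treeG (ends_neq mE).
by rewrite /first tE E.
Qed.

Lemma dcoord_lift_leaf u : dcoord (val u) (lift_vec lt a) = (lift_leaf a u)%:~R.
Proof.
rewrite dcoord_lift first_coef_leaf addr0 addrC (bigD1 u) //= eqxx.
rewrite [X in _ + X + _]big1 => [|m /negPf mn]; last by rewrite val_eqE mn.
rewrite big1 ?addr0 // => n _.
by rewrite (negPf (node_leaf_neq n u)).
Qed.

Lemma dcoord_lift_inner v : inner v ->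
  dcoord v (lift_vec lt a) = (first_coef v)%:~R.
Proof.
move=> iv; rewrite dcoord_lift !big1 ?add0r ?addr0 // => z _;
  case: eqP => // zv.
  by rewrite -zv inner_leaf in iv.
by rewrite -zv inner_node in iv.
Qed.

End ReducedLift.

(** * Dual coordinates from the values at the nodes *)

Section Parametrization.
Variable G : plumbing.
Hypothesis treeG : is_tree G.
Hypothesis nd : negative_definite G.
Hypothesis minG : minimal G.
Variable lt : rel (node G).
Hypothesis ltO : is_orientation lt.
Variable a : lift_coef G.
Variable nu : leaf G -> node G.
Hypothesis nuP : forall u n, (u \in node_leaves n) = (n == nu u).
Local Notation QL := {ffun G -> rat}.
Local Notation ZN := {ffun node G -> int}.
Implicit Types (x y : QL) (v w : G) (n m : node G) (u : leaf G) (l : ZN).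
Implicit Types (f : leaf G -> int).

(** The function N_a with a free integer f u in place of the floor belonging
    to the leaf u. *)
Definition free_N l f n : rat :=
  (lift_node a n)%:~R
  + \sum_(n' in nbr_nodes n | lt n n')
      (omega n n')%:~R / (alpha n n')%:~R * (lift_first a n n')%:~R
  + \sum_(n' in nbr_nodes n | lt n' n)
      1 / (alpha n n')%:~R * (lift_first a n' n)%:~R
  - ((euler (val n))%:~R
     + \sum_(n' in nbr_nodes n) (omega n n')%:~R / (alpha n n')%:~R)
    * (l n)%:~R
  - \sum_(n' in nbr_nodes n) (l n')%:~R / (alpha n n')%:~R
  + \sum_(u in node_leaves n) (f u)%:~R.

Definition free_leaf l f u : int :=
  lift_leaf a u - omega_leaf (nu u) u * l (nu u) - alpha_leaf (nu u) u * f u.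

(** The condition that y plus the lift has no coordinate on E*_v for the
    vertices v of valency two. *)
Definition solves_inner y :=
  forall v, inner v -> dcoord v y = - (first_coef lt a v)%:~R.

Lemma nu_leaf u : u \in node_leaves (nu u).
Proof. by rewrite nuP. Qed.

Lemma interior_inner n (e v : G) : e \in ends n -> v \in interior (val n) e ->
  inner v.
Proof.
move=> en vs; rewrite /inner (interior_le2 en vs) /=.
have [_ xs us] := interiorP treeG (ends_neq en).
by rewrite gtn_eqF // (interior_valency treeG xs us).
Qed.

Lemma inner_node_chain y n n' (A : rat) : solves_inner y ->
  n' \in nbr_nodes n ->
    lt n n' -> A = (lift_first a n n')%:~R ->
  [/\ (alpha n n')%:~R * y (first (val n) (val n'))
       = (omega n n')%:~R * (y (val n) - A) + y (val n'),
      (alpha n n')%:~R * (y (first (val n') (val n))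
                          - A *+ nilp (interior (val n) (val n')))
       = (omega n' n)%:~R * y (val n') + (y (val n) - A)
    & y (val n') \is a Num.int -> y (first (val n') (val n)) \is a Num.int ->
      y (first (val n) (val n')) \is a Num.int].
Proof.
move=> sy n'n l AE; have [|e1 e2 e3] := @node_chain G treeG y n n' (- A) n'n.
  move=> v vs; have nE := n'n; rewrite mem_nbr_nodes // in nE.
  rewrite -dcoord_inter // sy ?(interior_inner nE) //
    (first_coef_chain treeG ltO a n'n l) //.
  by rewrite AE rmorphMn mulNrn.
by split=> //; rewrite -mulNrn.
Qed.

Lemma inner_leaf_chain y u : solves_inner y ->
  (alpha_leaf (nu u) u)%:~R * y (first (val (nu u)) (val u))
    = (omega_leaf (nu u) u)%:~R * y (val (nu u)) + dcoord (val u) y.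
Proof.
move=> sy; rewrite dcoord_inter //; apply: leaf_chain;
  rewrite ?nu_leaf // => v vs.
have uE := nu_leaf u; rewrite mem_node_leaves // in uE.
rewrite -dcoord_inter // sy ?(interior_inner uE) //.
by rewrite (first_coef_leaf_chain treeG lt a (nu_leaf u) vs) oppr0.
Qed.

(** The neighbours of n begin the chains from n, whose equations are solved by
    [node_chain]; in each orientation of a chain its contribution, together
    with the coefficient that an empty chain gives to n, is a term of N_a. *)
Lemma node_equation y l f n : solves_inner y ->
    (forall m, y (val m) = (l m)%:~R) ->
    (forall u, y (first (val (nu u)) (val u)) = - (f u)%:~R) ->
  dcoord (val n) y + (lift_node a n)%:~R + (first_coef lt a (val n))%:~R =
    free_N l f n.
Proof.
move=> sy yl yf; rewrite dcoord_inter // /neg_inter_op (sum_neighbours treeG)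
  yl.
rewrite [X in _ - (_ + X)](eq_bigr (fun u => - (f u)%:~R)); last first.
  by move=> u; rewrite nuP => /eqP ->; rewrite yf.
rewrite sumrN (first_coef_node treeG) /free_N.
set F := \sum_(u in _) _; set b := (euler _)%:~R; set L := (l n)%:~R;
  set a0 := _%:~R.
(* Only the chains between nodes remain to be compared, one by one. *)
suff key : - \sum_(n' in nbr_nodes n) y (first (val n) (val n')) +
    (\sum_(m in nbr_nodes n | lt m n) lift_first a m n *+ nilp
      (interior (val n) (val m)))%:~R
  = \sum_(n' in nbr_nodes n | lt n n')
      (omega n n')%:~R / (alpha n n')%:~R * (lift_first a n n')%:~R
  + \sum_(n' in nbr_nodes n | lt n' n)
      1 / (alpha n n')%:~R * (lift_first a n' n)%:~R
  - (\sum_(n' in nbr_nodes n) (omega n n')%:~R / (alpha n n')%:~R) * L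
  - \sum_(n' in nbr_nodes n) (l n')%:~R / (alpha n n')%:~R.
  move: key; rewrite mulrDl.
  set s1 := \sum_(_ in _) y _; set s2 := (\sum_(_ in _ | lt _ n) _ *+ _)%:~R.
  set s3 := \sum_(_ in _ | lt n _) _; set s4 := \sum_(_ in _ | _) _.
  set s5 := (\sum_(_ in _) _) * L; set s6 := \sum_(_ in _) _; lra.
rewrite rmorph_sum /= mulr_suml -sumrN 2!big_mkcondr
  [X in _ = _ + X - _ - _]big_mkcondr.
rewrite -!sumrN -!big_split /=; apply: eq_bigr => n' n'n.
have al0 : (alpha n n')%:~R != 0 :> rat by rewrite intr_eq0 gt_eqF // alpha_gt0.
have [lnn|lnn] := boolP (lt n n').
  rewrite (orient_asym ltO n'n lnn) !addr0.
  have [e1 _ _] := inner_node_chain sy n'n lnn erefl.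
  apply: (mulfI al0); rewrite mulrN e1 !yl; field.
  exact: al0.
have ln'n : lt n' n by have := ltO n'n; rewrite (negPf lnn).
rewrite ln'n add0r.
have nn' : n \in nbr_nodes n' by rewrite -nbr_nodes_sym.
have [_ + _] := inner_node_chain sy nn' ln'n erefl.
rewrite (alpha_sym treeG n'n) (interior_sym treeG n'n) /nilp size_rev => e2.
rewrite [(_ *+ _)%:~R]rmorphMn /=; apply: (mulfI al0).
rewrite addrC -opprB mulrN e2 !yl; field.
exact: al0.
Qed.

End Parametrization.

(** * The points parametrized by node values and leaf integers *)

Section Points.
Variable G : plumbing.
Hypothesis treeG : is_tree G.
Hypothesis nd : negative_definite G.
Hypothesis minG : minimal G.
Variable lt : rel (node G).
Hypothesis ltO : is_orientation lt.
Variable a : lift_coef G.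
Variable nu : leaf G -> node G.
Hypothesis nuP : forall u n, (u \in node_leaves n) = (n == nu u).
Variable n0 : node G.
Local Notation QL := {ffun G -> rat}.
Local Notation ZN := {ffun node G -> int}.
Implicit Types (x y z : QL) (v w : G) (n m : node G) (u : leaf G) (l : ZN).
Implicit Types (f : leaf G -> int).
Local Notation free_N := (free_N lt a).
Local Notation free_leaf := (free_leaf a nu).
Local Notation lift_vec := (lift_vec lt a).

(** For l in Z^N(a) these are, by [lift_point_translate] and
    [lift_point_surj], the points of a + L without dual coordinates at the
    vertices of valency two. *)
Definition lift_point l f : QL := Estar_comb (free_N l f)
  (fun u => (free_leaf l f u)%:~R).

Lemma alpha_leaf_neq0 u : (alpha_leaf (nu u) u)%:~R != 0 :> rat.
Proof. by rewrite intr_eq0 gt_eqF // alpha_leaf_gt0 ?nu_leaf. Qed.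

(** Let y extend l with the required dual coordinates outside the nodes. The
    leaf chains give y the value - f u next to a node, and the congruences on
    l make y integral at one end of every chain between nodes; from there
    integrality spreads, and the coordinates at the nodes are forced by
    [node_equation]. *)
Lemma lift_point_translate l f : ZNa lt a l -> exists y,
  [/\ y \in latL G, forall n, y (val n) = (l n)%:~R
    & lift_point l f = lift_vec + y].
Proof.
move=> lZ; pose t v : rat := if insub v is Some u
  then (free_leaf l f u - lift_leaf a u)%:~R else - (first_coef lt a v)%:~R.
have [y [yl yt]] := dcoord_extension nd (fun n => (l n)%:~R) t.
have sy : solves_inner lt a y.
  by move=> v /andP[v2 v1]; rewrite yt // /t insubN.
have leaf2 u : (valency (val u) <= 2)%N by rewrite (eqP (valP u)).
have yu u : dcoord (val u) y = (free_leaf l f u - lift_leaf a u)%:~R.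
  by rewrite yt // /t valK.
have yf u : y (first (val (nu u)) (val u)) = - (f u)%:~R.
  apply: (mulfI (alpha_leaf_neq0 u)).
  rewrite (inner_leaf_chain treeG nuP u sy) yu yl -!(rmorphM, rmorphN, rmorphD).
  by congr (_ %:~R); rewrite /free_leaf; ring.
have far n n' : n' \in nbr_nodes n -> lt n n' ->
    y (first (val n') (val n)) \is a Num.int.
  move=> n'n lnn; have al0 : (alpha n n')%:~R != 0 :> rat.
    by rewrite intr_eq0 gt_eqF // alpha_gt0.
  have [_ e2 _] := inner_node_chain treeG ltO sy n'n lnn erefl.
  have /eqP := lZ n n' n'n lnn; rewrite eqz_mod_dvd => /dvdzP[k kE].
  have : y (first (val n') (val n)) =
    (k + lift_first a n n' *+ nilp (interior (val n) (val n')))%:~R.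
    rewrite rmorphD rmorphMn /= -[LHS](subrK
      ((lift_first a n n')%:~R *+ nilp (interior (val n) (val n')))).
    congr (_ + _); apply: (mulfI al0);
      rewrite e2 !yl [RHS]mulrC -[RHS]rmorphM -kE.
    by rewrite rmorphB rmorphD rmorphM; ring.
  by move=> ->; exact: intr_int.
exists y; split=> //.
  apply: (latL_of_nodes treeG n0) => [n|n e en|v v2].
  - by rewrite yl intr_int.
  - have [[n' n'n ->]|[u un ->]] := ends_terminal treeG en; last first.
      by move: un; rewrite nuP => /eqP ->; rewrite yf rpredN intr_int.
    have nn' : n \in nbr_nodes n' by rewrite -nbr_nodes_sym.
    have := ltO n'n; case: (boolP (lt n n')) => [lnn _|_ /= ln'n];
      last exact: far.
    have [_ _ e3] := inner_node_chain treeG ltO sy n'n lnn erefl.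
    by apply: e3; [rewrite yl intr_int|exact: far].
  have [[n vE]|[u ->]|iv] := vertexP v.
  - by rewrite vE leqNgt (valP n) in v2.
  - by rewrite yu intr_int.
  by rewrite sy // rpredN intr_int.
apply: (dcoord_inj nd) => v; rewrite [RHS](raddfD (dcoord v)) /= /lift_point.
have [[n ->]|[u ->]|iv] := vertexP v.
- rewrite dcoord_Estar_comb_node // dcoord_lift_node //.
  by rewrite -(node_equation treeG minG ltO nuP n sy yl yf); ring.
- rewrite dcoord_Estar_comb_leaf // dcoord_lift_leaf // yu.
  by rewrite -rmorphD /= addrC subrK.
by rewrite dcoord_Estar_comb_inner // dcoord_lift_inner // sy // subrr.
Qed.

(** The integers l and f are read off the integral vector z - a. *)
Lemma lift_point_surj z : z - lift_vec \in latL G ->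
    (forall v, inner v -> dcoord v z = 0) ->
  exists l f, [/\ ZNa lt a l, z = lift_point l f
    & forall n, z (val n) = lift_vec (val n) + (l n)%:~R].
Proof.
set y := z - lift_vec => yL z0; have /forallP yZ := yL.
have fK v : (Num.floor (y v))%:~R = y v by apply/eqP; rewrite -intrEfloor.
pose l : ZN := [ffun n => Num.floor (y (val n))].
pose f u := - Num.floor (y (first (val (nu u)) (val u))).
have yl n : y (val n) = (l n)%:~R by rewrite [l n]ffunE fK.
have yf u : y (first (val (nu u)) (val u)) =
  - (f u)%:~R by rewrite /f rmorphN opprK /= fK.
have zE : z = lift_vec + y by rewrite addrC subrK.
have sy : solves_inner lt a y.
  move=> v iv; rewrite (raddfB (dcoord v)) /= z0 // dcoord_lift_inner //.
  by rewrite sub0r.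
exists l, f; split.
- move=> n n' n'n lnn; apply/eqP; rewrite eqz_mod_dvd; apply/dvdzP.
  have [_ e2 _] := inner_node_chain treeG ltO sy n'n lnn erefl.
  exists (Num.floor (y (first (val n') (val n)))
          - lift_first a n n' *+ nilp (interior (val n) (val n'))).
  apply/eqP; rewrite -(eqr_int rat); apply/eqP; move: e2; rewrite !yl.
  rewrite !(rmorphM, rmorphB, rmorphD, rmorphMn) /= fK => e2.
  by rewrite [RHS]mulrC e2; ring.
- apply: (dcoord_inj nd) => v; rewrite /lift_point;
    have [[n ->]|[u ->]|iv] := vertexP v.
  + rewrite dcoord_Estar_comb_node //
      -(node_equation treeG minG ltO nuP n sy yl yf).
    by rewrite {1}zE (raddfD (dcoord _)) /= dcoord_lift_node //; ring.
  + rewrite dcoord_Estar_comb_leaf //.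
    have := inner_leaf_chain treeG nuP u sy; rewrite yf yl => e.
    rewrite {1}zE (raddfD (dcoord _)) /= dcoord_lift_leaf // /free_leaf.
    by rewrite !(rmorphB, rmorphM) /=; move: e; set d := dcoord _ _; lra.
  by rewrite dcoord_Estar_comb_inner // z0.
by move=> n; rewrite -yl {1}zE ffunE.
Qed.

End Points.

(** * The bijection and the exponents *)

Lemma fsbig_single (T : choiceType) (A : set T) (g : T) (F : T -> int) :
    (forall y, A y -> y != g -> F y = 0) ->
  \sum_(y \in A) F y = if g \in A then F g else 0.
Proof.
move=> F0; case: ifPn => [gA|gA]; last first.
  rewrite fsbig1 // => y Ay; apply: F0 => //; apply: contraNneq gA => <-.
  exact: mem_set.
rewrite (fsbigE [:: g]) //= => [||y Ay];
  first by rewrite big_cons big_nil gA addr0.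
  by move=> y; rewrite /= inE => /eqP ->; exact: set_mem.
by rewrite inE; exact: F0.
Qed.

Lemma fsbig_only (T : choiceType) (g : T) (F : T -> int) :
  (forall y, y != g -> F y = 0) -> \sum_(y \in [set: T]%classic) F y = F g.
Proof.
by move=> F0; rewrite (fsbig_single (g := g)) ?in_setT // => y _; exact: F0.
Qed.

Lemma conv_mono (T : zmodType) (g k : T) : conv (mono g) (mono k) =
  mono (g + k).
Proof.
apply/funext => x; rewrite /conv (fsbig_only (g := g)) => [|y /negPf yg].
  by rewrite /mono eqxx mul1r subr_eq addrC.
by rewrite /mono yg mul0r.
Qed.

Lemma big_conv_mono (T : zmodType) (I : finType) (g : I -> T) :
  \big[@conv _/@sone _]_i mono (g i) = mono (\sum_i g i).
Proof.
elim/big_ind2: _ => // A x B y -> ->; exact: conv_mono.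
Qed.

Section Bijection.
Variable G : plumbing.
Hypothesis treeG : is_tree G.
Hypothesis nd : negative_definite G.
Hypothesis minG : minimal G.
Variable lt : rel (node G).
Hypothesis ltO : is_orientation lt.
Variable a : lift_coef G.
Variable nu : leaf G -> node G.
Hypothesis nuP : forall u n, (u \in node_leaves n) = (n == nu u).
Variable n0 : node G.
Local Notation QL := {ffun G -> rat}.
Local Notation ZN := {ffun node G -> int}.
Implicit Types (x y z : QL) (v w : G) (n m : node G) (u : leaf G) (l : ZN).
Implicit Types (f : leaf G -> int).
Local Notation free_N := (free_N lt a).
Local Notation free_leaf := (free_leaf a nu).
Local Notation lift_vec := (lift_vec lt a).
Local Notation Na := (Na lt a).
Local Notation lift_point := (lift_point lt a nu).

Definition leaf_floor l u : int :=
  Num.floor ((lift_leaf a u - omega_leaf (nu u) u * l (nu u))%:~R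
             / (alpha_leaf (nu u) u)%:~R : rat).

Lemma Na_free_N l n : Na l n = free_N l (leaf_floor l) n.
Proof.
rewrite /Na /free_N; congr (_ + _); apply: eq_bigr => u.
by rewrite nuP => /eqP ->.
Qed.

Lemma x_of_lift_point l : x_of lt a l = lift_point l (leaf_floor l).
Proof.
rewrite /x_of /lift_point /Estar_comb; congr (_ + _).
  by apply: eq_bigr => n _; rewrite Na_free_N.
rewrite (exchange_big_dep xpredT) //=; apply: eq_bigr => u _.
rewrite (big_pred1 (nu u)) => [|n]; last by rewrite nuP eq_sym.
congr scaleQ; rewrite /frac mulrBr mulrC divfK ?alpha_leaf_neq0 //.
by rewrite -rmorphM -rmorphB.
Qed.

(** The Euclidean division of a_u - omega_u l_n by alpha_u. *)
Lemma free_leaf_floorP l f u :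
  (0 <= free_leaf l f u < alpha_leaf (nu u) u) = (f u == leaf_floor l u).
Proof.
have al : 0 < (alpha_leaf (nu u) u)%:~R :> rat.
  by rewrite ltr0z alpha_leaf_gt0 ?nu_leaf.
rewrite eq_sym /leaf_floor floor_eq ler_pdivlMr // ltr_pdivrMr //.
rewrite -(ler_int rat) -(ltr_int rat) /free_leaf.
rewrite !(rmorphB, rmorphM, rmorphD) /=.
by apply/andP/andP => -[p1 p2]; split; lra.
Qed.

Lemma lift_point_node l f : ZNa lt a l ->
  forall n, lift_point l f (val n) = lift_vec (val n) + (l n)%:~R.
Proof.
move=> lZ n; have [y [_ yl ->]] :=
  lift_point_translate treeG nd minG ltO nuP n0 f lZ.
by rewrite ffunE yl.
Qed.

Lemma class_lift_point l f : ZNa lt a l -> class (lift_point l f) =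
  class lift_vec.
Proof.
move=> lZ; have [y [yL _ ->]] := lift_point_translate treeG nd minG ltO nuP n0 f
  lZ.
by apply/class_eq; rewrite addrC addKr.
Qed.

Lemma free_N_int l f n : ZNa lt a l -> free_N l f n \is a Num.int.
Proof.
move=> lZ; rewrite -(dcoord_Estar_comb_node nd _
  (fun u => (free_leaf l f u)%:~R)).
have [y [yL _ yE]] := lift_point_translate treeG nd minG ltO nuP n0 f lZ.
rewrite -/(lift_point l f) yE (raddfD (dcoord _)) /= dcoord_lift_node //.
by rewrite !rpredD ?intr_int // dcoord_int.
Qed.

Lemma piN_lift_point l f : ZNa lt a l -> piN (lift_point l f) =
  c_vec lt a + ratN l.
Proof. by move=> lZ; apply/ffunP => n;
  rewrite [LHS]ffunE lift_point_node // !ffunE. Qed.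

Lemma ratN_inj : injective (@ratN G).
Proof.
move=> l l' /ffunP E; apply/ffunP => n; have := E n; rewrite !ffunE.
by move/eqP; rewrite eqr_int => /eqP.
Qed.

Lemma mono_nodes l : mono (c_vec lt a + ratN l) =
  \big[@conv _/@sone _]_n mono (scaleQ (c_vec lt a n + (l n)%:~R) (Evec n)).
Proof.
rewrite big_conv_mono; congr mono; apply/ffunP => n.
rewrite sum_ffunE (bigD1 n) //= big1 => [|m /negPf mn].
  by rewrite !ffunE eqxx mulr1 addr0.
by rewrite !ffunE mn mulr0.
Qed.

(** Of the integers (l, f) describing a point, the leaf bounds determine f;
    the point in turn determines l through its coordinates at the nodes. *)
Lemma x_of_bij h : is_reduced_lift lt a h ->
  set_bij (Sa lt a) (Xh h) (x_of lt a).
Proof.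
move=> ah; split.
- move=> l [lZ lS].
  exists (fun n => Num.floor (Na l n)), (free_leaf l (leaf_floor l)).
  have NK n : (Num.floor (Na l n))%:~R = Na l n.
    by apply/eqP; rewrite -intrEfloor Na_free_N free_N_int.
  split.
  + rewrite x_of_lift_point /lift_point /Estar_comb; congr (_ + _);
      apply: eq_bigr => z _.
      by rewrite Estar_mulrz // NK Na_free_N.
    by rewrite Estar_mulrz.
  + by rewrite x_of_lift_point class_lift_point // ah.
  + by move=> n u; rewrite nuP => /eqP ->; rewrite free_leaf_floorP.
  move=> n; have [N0 N1] := lS n; split; first by rewrite -(ler_int rat) NK.
  move=> /N1 N2; rewrite -(ler_int rat) NK (le_trans N2) // rmorphB /=.
  by rewrite pmulrn.
- move=> l l' /set_mem[lZ _] /set_mem[l'Z _];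
    rewrite !x_of_lift_point => /(congr1 (@piN G)).
  by rewrite !piN_lift_point // => /addrI /ratN_inj.
move=> x [xN [xE [xD xh leafP nodeP]]].
have xC : x = Estar_comb (fun n => (xN n)%:~R) (fun u => (xE u)%:~R).
  by rewrite xD /Estar_comb; congr (_ + _); apply: eq_bigr => z _;
    rewrite Estar_mulrz.
have [|v iv|l [f [lZ xP _]]] := lift_point_surj treeG nd minG ltO nuP (a := a)
  (z := x).
- by apply/class_eq; rewrite xh ah.
- by rewrite xC dcoord_Estar_comb_inner.
have fE : f = leaf_floor l.
  apply/funext => u; apply/eqP; rewrite -free_leaf_floorP.
  suff -> : free_leaf l f u = xE u by apply: leafP; exact: nu_leaf.
  apply/eqP; rewrite -(eqr_int rat); apply/eqP.
  rewrite -(dcoord_Estar_comb_leaf nd (free_N l f)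
    (fun u => (free_leaf l f u)%:~R)).
  by rewrite -/(lift_point l f) -xP xC dcoord_Estar_comb_leaf.
exists l; last by rewrite x_of_lift_point xP fE.
split=> // n; have [x0 x1] := nodeP n.
have -> : Na l n = (xN n)%:~R.
  rewrite Na_free_N -fE -(dcoord_Estar_comb_node nd (free_N l f)
    (fun u => (free_leaf l f u)%:~R)).
  by rewrite -/(lift_point l f) -xP xC dcoord_Estar_comb_node.
split; first by rewrite ler0z.
by move=> /x1; rewrite -(ler_int rat) rmorphB /= -pmulrn.
Qed.

End Bijection.

(** * Coefficients of powers of 1-s *)

(** The coefficient of s^k in the expansion of (1-s)^m, for m >= -1. *)
Definition pow_coef (m k : int) : int :=
  if k is Posz i then if m is Posz d then (-1) ^+ i * 'C(d, i)%:Z else 1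
  else 0.

Lemma pow_coef_lt0 m k : k < 0 -> pow_coef m k = 0.
Proof. by case: k. Qed.

(** The coefficients of (1-s)^m = (1-s) (1-s)^(m-1). *)
Lemma pow_coef_pascal m k : 0 <= m ->
  pow_coef m k = pow_coef (m - 1) k - pow_coef (m - 1) (k - 1).
Proof.
have S1 (i : nat) : i.+1%:Z - 1 = i%:Z by lia.
case: m k => // -[|d] [[|i]|i] _ //; rewrite ?S1 ?sub0r.
- by rewrite /= bin0n mulr0.
- by rewrite /= !bin0 subr0.
by rewrite /= binS PoszD exprS; ring.
Qed.

(** Division of (1-s)^m by 1-s; the sum telescopes by [pow_coef_pascal]. *)
Lemma sum_pow_coef m k (B : nat) : 0 <= m -> k <= B%:Z ->
  \sum_(i < B.+1) pow_coef m (k - i%:Z) = pow_coef (m - 1) k.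
Proof.
move=> m0 kB; pose F i := pow_coef (m - 1) (k - i%:Z).
rewrite (eq_bigr (fun i : 'I_B.+1 => - (F i.+1 - F i))) => [|i _]; last first.
  rewrite pow_coef_pascal // opprB; congr (_ - pow_coef _ _); lia.
rewrite sumrN -(big_mkord xpredT (fun i => F i.+1 - F i)) telescope_sumr //.
by rewrite opprB /F subr0 [pow_coef _ (k - _)]pow_coef_lt0 ?subr0 //; lia.
Qed.

Section LeafSum.
Variables (N U : finType) (nu : U -> N) (B : nat).

(** Every u in r divides the power at the index nu u by 1-s. The induction
    sums over the value of j at the head of r first. *)
Lemma sum_pow_coef_fibres (m X : N -> int) (r : seq U) : uniq r ->
    (forall n, X n <= B%:Z) ->
    (forall n, (count (fun u => nu u == n) r)%:Z - 1 <= m n) ->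
  \sum_(j : {ffun U -> 'I_B.+1} | [forall u, (u \in r) || (j u == ord0)])
     \prod_n pow_coef (m n) (X n - \sum_(u | nu u == n) (j u)%:Z)
  = \prod_n pow_coef (m n - (count (fun u => nu u == n) r)%:Z) (X n).
Proof.
elim: r X => [|u0 r IH] X /=.
  move=> _ XB mB; rewrite (big_pred1 [ffun=> ord0]) => [|j]; last first.
    apply/forallP/eqP => [j0|-> u]; last by rewrite ffunE.
    by apply/ffunP => u; rewrite ffunE; apply/eqP/j0.
  apply: eq_bigr => n _; rewrite big1 ?subr0 // => u _.
  by rewrite ffunE.
move=> /andP[u0r ur] XB mB.
(* Split j into its value at u0 and the rest, set to 0 at u0. *)
pose upd (j : {ffun U -> 'I_B.+1}) k := [ffun u => if u == u0 then k else j u].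
rewrite (partition_big (fun j : {ffun U -> 'I_B.+1} => j u0) xpredT) //=.
have inner (k : 'I_B.+1) :
    \sum_(j : {ffun U -> 'I_B.+1} |
          [forall u, (u \in u0 :: r) || (j u == ord0)] && (j u0 == k))
       \prod_n pow_coef (m n) (X n - \sum_(u | nu u == n) (j u)%:Z)
    = \prod_n pow_coef (m n - (count (fun u => nu u == n) r)%:Z)
                       (X n - k%:Z *+ (nu u0 == n)).
  rewrite -IH // => [|n|n]; last 2 first.
  - by case: (_ == _); rewrite ?subr0 // lerBlDr (le_trans (XB n)) // lerDl.
  - by apply: le_trans (mB n); rewrite lerD2r lez_nat leq_addl.
  rewrite (reindex_onto (fun j => upd j k) (fun j => upd j ord0)); last first.
    move=> j /andP[_ /eqP jk]; apply/ffunP => u; rewrite !ffunE.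
    by case: eqP => // ->.
  apply: eq_big => [j|j].
    apply/andP/forallP => [[/andP[/forallP jr _] /eqP jE] u|jr].
      have /ffunP/(_ u) := jE; rewrite !ffunE.
      case: eqP => [_ <-|/eqP uN _]; first by rewrite eqxx orbT.
      by have := jr u; rewrite inE (negPf uN) /= ffunE (negPf uN).
    have ju0 : j u0 = ord0 by apply/eqP; have := jr u0; rewrite (negPf u0r).
    split; last by apply/eqP/ffunP => u; rewrite !ffunE; case: eqP => // ->.
    rewrite ffunE !eqxx; apply/andP; split=> //; apply/forallP => u;
      rewrite inE ffunE.
    by case: eqP => //= _; exact: jr.
  move=> /andP[_ /eqP jE]; have ju0 : j u0 = ord0.
    by have /ffunP/(_ u0) := jE; rewrite !ffunE eqxx.
  apply: eq_bigr => n _; congr (pow_coef _ _); rewrite -addrA -opprD;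
    congr (_ - _).
  have [nE|nE] := eqVneq (nu u0) n; last first.
    rewrite add0r; apply: eq_bigr => u /eqP un; rewrite ffunE.
    by case: eqP => // uE; rewrite -uE un eqxx in nE.
  rewrite (bigD1 u0) ?nE //= ffunE eqxx; congr (_ + _).
  rewrite [RHS](bigD1 u0) ?nE //= ju0 add0r.
  by apply: eq_bigr => u /andP[_ /negPf uN]; rewrite ffunE uN.
rewrite (eq_bigr _ (fun k _ => inner k)) {inner IH}.
rewrite (eq_bigr (fun k : 'I_B.+1 =>
   pow_coef (m (nu u0) - (count (fun u => nu u == nu u0) r)%:Z)
     (X (nu u0) - k%:Z)
   * \prod_(n | n != nu u0) pow_coef (m n - (count (fun u => nu u == n) r)%:Z)
     (X n))); last first.
  move=> k _; rewrite (bigD1 (nu u0)) //= eqxx; congr (_ * _).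
  by apply: eq_bigr => n nN; rewrite eq_sym (negPf nN) subr0.
rewrite -mulr_suml sum_pow_coef //; last first.
  by have := mB (nu u0); rewrite eqxx; lia.
rewrite [RHS](bigD1 (nu u0)) //= eqxx; congr (_ * _).
  by congr (pow_coef _ _); lia.
by apply: eq_bigr => n nN; rewrite eq_sym (negPf nN).
Qed.

Lemma sum_pow_coef_all (m X : N -> int) :
    (forall n, X n <= B%:Z) ->
    (forall n, #|[set u | nu u == n]|%:Z - 1 <= m n) ->
  \sum_(j : {ffun U -> 'I_B.+1})
     \prod_n pow_coef (m n) (X n - \sum_(u | nu u == n) (j u)%:Z)
  = \prod_n pow_coef (m n - #|[set u | nu u == n]|%:Z) (X n).
Proof.
move=> XB mB.
have cE n : count (fun u => nu u == n) (enum U) = #|[set u | nu u == n]|.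
  rewrite -sum1_card -sum1_count big_enum_cond.
  by apply: eq_bigl => u; rewrite inE.
under [RHS]eq_bigr do rewrite -cE.
rewrite -sum_pow_coef_fibres ?enum_uniq // => [|n]; last by rewrite cE.
by apply: eq_bigl => j; symmetry; apply/forallP => u; rewrite mem_enum.
Qed.

End LeafSum.

(** * Coefficients of the equivariant series *)

(** No positive multiple of g vanishes, so the powers of the monomial with
    exponent g are distinct and coefficients can be read off one by one. *)
Lemma pow_one_minus_coef (T : zmodType) (g : T) (m : int) :
    (forall k, g *+ k.+1 != 0) -> -1 <= m ->
  (forall k : nat, pow_one_minus g m (g *+ k) = pow_coef m k%:Z)
  /\ (forall x, (forall k, x != g *+ k) -> pow_one_minus g m x = 0).
Proof.
move=> gk; have gI : injective (fun k => g *+ k).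
  move=> i j; wlog ij : i j / (i <= j)%N => [W|].
    by case: (leqP i j) => [/W|/ltnW /W Wij /esym/Wij].
  move/subnKC: ij => <- /esym/eqP; rewrite mulrnDr -subr_eq0 addrAC subrr add0r.
  by case: (j - i)%N => [|k]; [rewrite addn0|rewrite (negPf (gk k))].
have g0 : g != 0 := gk 0%N.
case: m => [d|[|//]] _ /=; last first.
  have cE : conv (geom g) (@sone T) = geom g.
    apply/funext => x; rewrite /conv (fsbig_only (g := x)) => [|y yx].
      by rewrite /sone /mono subrr eqxx mulr1.
    by rewrite /sone /mono subr_eq0 eq_sym (negPf yx) mulr0.
  rewrite cE /geom /fsum; split=> [k|x xN].
    rewrite (fsbig_only (g := k)) => [|j jk]; first by rewrite /mono eqxx.
    by rewrite /mono (inj_eq gI) eq_sym (negPf jk).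
  by rewrite fsbig1 // => k _; rewrite /mono (negPf (xN k)).
elim: d => [|d [IH1 IH0]].
  split=> [k|x xN] /=; rewrite /sone /mono; last by have := xN 0%N;
    rewrite mulr0n => /negPf->.
  have -> : (g *+ k == 0) = (k == 0%N) by rewrite -(inj_eq gI) mulr0n.
  rewrite bin0n.
  by case: k => [|k]; rewrite ?expr0 ?mulr0 ?mulr1.
split=> [k|x xN]; rewrite /= conv_one_minus //; last first.
  rewrite !IH0 ?subr0 // => k; apply: contra (xN k.+1).
  by rewrite mulrSr subr_eq.
have := @pow_coef_pascal d.+1 k isT.
have -> : d.+1%:Z - 1 = d by lia.
rewrite /= => ->; rewrite IH1; congr (_ - _); case: k => [|k].
  rewrite mulr0n IH0 // => j; rewrite sub0r eq_sym -subr_eq0 opprK -mulrSr.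
  exact: gk.
rewrite mulrSr addrK IH1; have -> : k.+1%:Z - 1 = k by lia.
by [].
Qed.

Section SeriesCoefficients.
Variable G : plumbing.
Hypothesis treeG : is_tree G.
Hypothesis nd : negative_definite G.
Local Notation QL := {ffun G -> rat}.
Implicit Types (x y : QL) (v w : G) (c : QLmodL G).

Definition pow_coefq (m : int) (q : rat) : int :=
  if q \is a Num.int then pow_coef m (Num.floor q) else 0.

Lemma pow_coefq_int m (k : int) : pow_coefq m k%:~R = pow_coef m k.
Proof. by rewrite /pow_coefq intr_int intrKfloor. Qed.

Definition generator v : QL * QLmodL G := (Estar v, class (Estar v)).

Lemma generator_mulrn v k : generator v *+ k =
  (Estar v *+ k, class (Estar v *+ k)).
Proof.
rewrite (surjective_pairing (generator v *+ k)); congr (_, _).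
  by rewrite (raddfMn fst).
by rewrite (raddfMn snd) /= (raddfMn (@class G)).
Qed.

Lemma dcoord_Estar_mulrn v w k : dcoord w (Estar v *+ k) = k%:R *+ (v == w).
Proof.
by rewrite (raddfMn (dcoord w)) /= dcoord_Estar // -mulrnA mulnC mulrnA.
Qed.

Lemma generator_mulrn_neq0 v k : generator v *+ k.+1 != 0.
Proof.
rewrite generator_mulrn; apply/eqP => /(congr1 fst) /= E.
have := dcoord_Estar_mulrn v v k.+1;
  rewrite E (raddf0 (dcoord v)) eqxx => /esym/eqP.
by rewrite pnatr_eq0.
Qed.

Definition exponent v : int := (valency v)%:Z - 2.

(** The E*_v are linearly independent, so each convolution has at most one
    nonzero term: the power of the factor at v must be the coordinate of x on
    E*_v. *)
Lemma big_conv_coef (r : seq G) x c : uniq r ->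
    (forall v, v \in r -> (0 < valency v)%N) ->
  (\big[@conv _/@sone _]_(v <- r) pow_one_minus (generator v) (exponent v))
    (x, c) =
  (c == class x)%:Z *
  \prod_w (if w \in r then pow_coefq (exponent w) (dcoord w x)
           else (dcoord w x == 0)%:Z).
Proof.
elim: r x c => [|v r IH] x c.
  move=> _ _; rewrite big_nil /sone /mono.
  have [->|x0] := eqVneq x 0.
    rewrite (raddf0 (@class G)) big1 ?mulr1 => [|w _];
      last by rewrite (raddf0 (dcoord w)) eqxx.
    by rewrite xpair_eqE eqxx.
  rewrite xpair_eqE (negPf x0) /=.
  have [w wN] : exists w, dcoord w x != 0.
    apply/not_existsP => N; case/eqP: x0; apply: (dcoord_inj nd) => w.
    by rewrite (raddf0 (dcoord w)); apply/eqP/negPn/negP/N.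
  by rewrite (bigD1 w) //= (negPf wN) mul0r mulr0.
move=> /= /andP[vr ur] val_gt0; rewrite big_cons.
have v0 := val_gt0 v (mem_head _ _).
have [P1 P0] := pow_one_minus_coef (generator_mulrn_neq0 v) (m := exponent v)
  ltac:(rewrite /exponent; lia).
have IH' y d := IH y d ur (fun w wr => val_gt0 w (@mem_behead _ (v :: r) w wr)).
have F0 j : dcoord v x != j%:R ->
    (\big[@conv _/@sone _]_(w <- r) pow_one_minus (generator w) (exponent w))
      ((x, c) - generator v *+ j) = 0.
  move=> jN; rewrite generator_mulrn IH' (bigD1 v) //= (negPf vr).
  rewrite (raddfB (dcoord v)) /= dcoord_Estar_mulrn eqxx mulr1n subr_eq0
    (negPf jN).
  by rewrite mul0r mulr0.
have term0 (y : QL * QLmodL G) : (forall j, dcoord v x = j%:R -> y !=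
  generator v *+ j) ->
    pow_one_minus (generator v) (exponent v) y *
    (\big[@conv _/@sone _]_(w <- r) pow_one_minus (generator w) (exponent w))
      ((x, c) - y) = 0.
  move=> yN; have [[j yE]|N] := pselect (exists j, y = generator v *+ j);
    last first.
    by rewrite P0 ?mul0r // => k; apply/eqP => yk; apply: N; exists k.
  rewrite yE F0 ?mulr0 //; apply/eqP => xj.
  by have := yN j xj; rewrite yE eqxx.
rewrite (bigD1 v) //= mem_head.
have [xZ|xZ] := boolP (dcoord v x \is a Num.nat); last first.
  rewrite /conv fsbig1 => [|y _]; last first.
    by apply: term0 => j xj; rewrite xj natr_nat in xZ.
  rewrite /pow_coefq; case: ifP => [xI|]; last by rewrite mul0r mulr0.
  rewrite pow_coef_lt0 ?mul0r ?mulr0 // ltNge; apply: contra xZ => x0.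
  by rewrite -intrEge0 // -(eqP (etrans (esym (intrEfloor _)) xI)) ler0z.
have /natrP[k xk] := xZ.
rewrite /conv (fsbig_only (g := generator v *+ k)) => [|y yN]; last first.
  apply: term0 => j; rewrite xk => /eqP; rewrite eqr_nat => /eqP <-.
  exact: yN.
rewrite P1 generator_mulrn IH' xk -[k%:R]/(k%:Z%:~R) pow_coefq_int.
have -> : (c - class (Estar v *+ k) == class (x - Estar v *+ k)) =
  (c == class x).
  by rewrite (raddfB (@class G)) /= (inj_eq (addIr _)).
rewrite mulrCA; congr (_ * (_ * _)); rewrite (bigD1 v) //= (negPf vr).
rewrite (raddfB (dcoord v)) /= dcoord_Estar_mulrn eqxx mulr1n xk subrr eqxx
  mul1r.
apply: eq_bigr => w wv; rewrite inE (negPf wv) /=.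
rewrite (raddfB (dcoord w)) /= dcoord_Estar_mulrn.
by rewrite eq_sym (negPf wv) mulr0n subr0.
Qed.

Lemma coef_pE x : (forall v, (0 < valency v)%N) ->
  coef_p x = \prod_v pow_coefq (exponent v) (dcoord v x).
Proof.
move=> v0; rewrite /coef_p /Z_H big_conv_coef ?index_enum_uniq //.
by rewrite eqxx mul1r; apply: eq_bigr => v _; rewrite mem_index_enum.
Qed.

End SeriesCoefficients.

(** * The reduced series *)

Section ReducedSeries.
Variable G : plumbing.
Hypothesis treeG : is_tree G.
Hypothesis nd : negative_definite G.
Hypothesis minG : minimal G.
Variable lt : rel (node G).
Hypothesis ltO : is_orientation lt.
Variable a : lift_coef G.
Variable nu : leaf G -> node G.
Hypothesis nuP : forall u n, (u \in node_leaves n) = (n == nu u).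
Variable n0 : node G.
Local Notation QL := {ffun G -> rat}.
Local Notation ZN := {ffun node G -> int}.
Implicit Types (x y z : QL) (v w : G) (n m : node G) (u : leaf G) (l : ZN).
Implicit Types (f : leaf G -> int).
Local Notation free_N := (free_N lt a).
Local Notation free_leaf := (free_leaf a nu).
Local Notation lift_vec := (lift_vec lt a).
Local Notation Na := (Na lt a).
Local Notation lift_point := (lift_point lt a nu).
Local Notation leaf_floor := (leaf_floor a nu).

Lemma valency_pos v : (0 < valency v)%N.
Proof.
have [->|vn] := eqVneq v (val n0); first by rewrite (leq_trans _ (valP n0)).
exact: valency_gt0 (adj_first treeG vn).
Qed.

Lemma exponent_inner v : inner v -> exponent v = 0.
Proof.
by move=> /andP[]; have := valency_pos v; rewrite /exponent;
  case: (valency v) => [|[|[|]]].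
Qed.

Lemma exponent_leaf u : exponent (val u) = -1.
Proof. by rewrite /exponent (eqP (valP u)). Qed.

Lemma pow_coefq_ge0 (e : int) q : pow_coefq e q != 0 -> q \is a Num.nat.
Proof.
rewrite /pow_coefq; case: ifP => [qZ|]; last by rewrite eqxx.
case: (leP 0 (Num.floor q)) => [q0 _|/pow_coef_lt0 ->]; last by rewrite eqxx.
by rewrite -intrEge0 // -(eqP (etrans (esym (intrEfloor _)) qZ)) ler0z.
Qed.

Lemma coef_p_support x : coef_p x != 0 ->
  (forall v, dcoord v x \is a Num.nat)
  /\ (forall v, inner v -> dcoord v x = 0).
Proof.
rewrite (coef_pE nd x valency_pos) => /prodf_neq0 N0.
split=> v => [|iv]; have := N0 v isT; first exact: pow_coefq_ge0.
rewrite exponent_inner // => /[dup] /pow_coefq_ge0 /natrP[k ->].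
by case: k => // k; rewrite -[k.+1%:R]/(k.+1%:Z%:~R) pow_coefq_int /=
  bin0n mulr0.
Qed.

Lemma coef_p_lift_point l f : (forall u, 0 <= free_leaf l f u) ->
  coef_p (lift_point l f) = \prod_n pow_coefq (exponent (val n)) (free_N l f n).
Proof.
move=> leaf_ge0; rewrite (coef_pE nd _ valency_pos).
transitivity (\prod_(v in val @: [set: node G])
                 pow_coefq (exponent v) (dcoord v (lift_point l f))).
  rewrite [RHS]big_mkcond; apply: eq_bigr => v _; case: ifPn => // vN.
  have [[n vE]|[u ->]|iv] := vertexP v.
  - by rewrite vE imset_f in vN.
  - rewrite dcoord_Estar_comb_leaf // pow_coefq_int exponent_leaf.
    by case: (free_leaf l f u) (leaf_ge0 u).
  by rewrite dcoord_Estar_comb_inner // exponent_inner // -[0]/(0%:~R)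
    pow_coefq_int.
rewrite big_imset /=; last by apply: in2W; exact: val_inj.
by apply: eq_big => [n|n _]; rewrite ?inE // dcoord_Estar_comb_node.
Qed.

Lemma Z_hE h x : Z_h h x = if class x == h then coef_p x else 0.
Proof.
rewrite /Z_h /fsum (fsbig_single (g := x)) => [|y _ yx]; last first.
  by rewrite /mono eq_sym (negPf yx) mulr0.
rewrite /mono eqxx mulr1; have [p0|p0] := eqVneq (coef_p x) 0.
  by rewrite p0 !if_same.
have [xN _] := coef_p_support p0; congr (if _ then _ else _).
apply/idP/eqP => [/set_mem[]//|xh]; apply/mem_set; split=> //.
by apply: dualL_dcoord => v; apply: intr_nat.
Qed.

Lemma free_leaf_shift l (j : leaf G -> int) u :
  free_leaf l (fun u => leaf_floor l u - j u) u
    = free_leaf l (leaf_floor l) u + alpha_leaf (nu u) u * j u.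
Proof. by rewrite /free_leaf; ring. Qed.

Lemma free_N_shift l (j : leaf G -> int) n :
  free_N l (fun u => leaf_floor l u - j u) n =
    Na l n - \sum_(u | nu u == n) (j u)%:~R.
Proof.
rewrite (Na_free_N lt a nuP) /free_N -[RHS]addrA; congr (_ + _).
rewrite (eq_bigl (fun u => nu u == n)) => [|u]; last by rewrite nuP eq_sym.
rewrite [in RHS](eq_bigl (fun u => nu u == n)) => [|u];
  last by rewrite nuP eq_sym.
by rewrite -sumrB; apply: eq_bigr => u _; rewrite rmorphB.
Qed.

Section Point.
Variables (h : QLmodL G) (l : ZN).
Hypothesis ah : is_reduced_lift lt a h.
Hypothesis lZ : ZNa lt a l.

Definition N_int n : int := Num.floor (Na l n).

Lemma N_intK n : (N_int n)%:~R = Na l n.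
Proof. by apply/eqP; rewrite -intrEfloor (Na_free_N lt a nuP)
  (free_N_int treeG nd minG ltO nuP n0). Qed.

Definition N_bound : nat := (\sum_n `|N_int n|)%N.

Lemma N_int_le n : N_int n <= N_bound%:Z.
Proof.
rewrite (le_trans (ler_norm _)) // -abszE lez_nat /N_bound (bigD1 n) //=.
exact: leq_addr.
Qed.

(** The points with node values l that can carry a nonzero coefficient: j u
    tells how far the integer at u lies below the floor. *)
Definition shifted_point (j : {ffun leaf G -> 'I_N_bound.+1}) : QL :=
  lift_point l (fun u => leaf_floor l u - (j u)%:Z).

Lemma shifted_point_inj : injective shifted_point.
Proof.
move=> j j' E; apply/ffunP => u; apply/val_inj.
have := congr1 (dcoord (val u)) E; rewrite !dcoord_Estar_comb_leaf // => /eqP.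
rewrite eqr_int !free_leaf_shift (inj_eq (addrI _)) => /eqP/mulfI.
by rewrite gt_eqF ?alpha_leaf_gt0 ?nu_leaf // => /(_ isT) [].
Qed.

Lemma free_leaf_floor_bounds u : 0 <=
  free_leaf l (leaf_floor l) u < alpha_leaf (nu u) u.
Proof. by rewrite free_leaf_floorP. Qed.

Lemma coef_p_shifted_point j : coef_p (shifted_point j) =
  \prod_n pow_coef (exponent (val n)) (N_int n - \sum_(u | nu u == n) (j u)%:Z).
Proof.
rewrite coef_p_lift_point => [|u]; last first.
  have /andP[X0 _] := free_leaf_floor_bounds u;
    rewrite free_leaf_shift addr_ge0 // mulr_ge0 //.
  by rewrite ltW // alpha_leaf_gt0 ?nu_leaf.
apply: eq_bigr => n _; rewrite free_N_shift -N_intK -pow_coefq_int.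
by rewrite rmorphB rmorph_sum.
Qed.

(** The coordinate at u is nonnegative, so the integer at u is at most the
    floor; the coordinate at the node of u is nonnegative, which bounds j
    u. *)
Lemma shifted_point_surj x : coef_p x != 0 -> class x = h ->
  piN x = c_vec lt a + ratN l -> exists j, x = shifted_point j.
Proof.
move=> x0 xh xl; have [xN xi] := coef_p_support x0.
have [|//|l' [f [l'Z xE _]]] := lift_point_surj treeG nd minG ltO nuP (a := a)
  (z := x).
  by apply/class_eq; rewrite xh ah.
have ll : l' = l.
  apply: (@ratN_inj G); apply: (addrI (c_vec lt a)).
  by rewrite -xl xE piN_lift_point.
subst l'; pose k u := leaf_floor l u - f u.
have fE : f = fun u => leaf_floor l u - k u by apply/funext => u;
  rewrite /k opprB addrC subrK.
(* The coordinate at u is alpha_u (k u) plus a remainder below alpha_u. *)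
have k0 u : 0 <= k u.
  have := xN (val u); rewrite xE dcoord_Estar_comb_leaf // fE free_leaf_shift.
  have /andP[X0 X1] := free_leaf_floor_bounds u => /natr_ge0; rewrite ler0z.
  by have := alpha_leaf_gt0 treeG minG (nu_leaf nuP u); nia.
have kB u : k u <= N_bound%:Z.
  have := xN (val (nu u)); rewrite xE dcoord_Estar_comb_node // fE free_N_shift
    -N_intK.
  move=> /natr_ge0; rewrite -rmorph_sum -rmorphB ler0z subr_ge0 => /le_trans S.
  have := S _ (N_int_le (nu u)); apply: le_trans.
  by rewrite (bigD1 u) //= lerDl sumr_ge0.
exists [ffun u => inord `|k u|]; rewrite xE /shifted_point fE; congr lift_point;
  apply/funext => u.
rewrite ffunE inordK ?gez0_abs // ltnS -lez_nat gez0_abs //.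
Qed.

(** The coefficients at leaves are all 1, so the sum over j is that of
    [sum_pow_coef_all], with m_n = delta_n - 2. The powers never drop below
    (1-s)^(-1), since every node has a neighbouring node. *)
Lemma reduce_nodes_point : (1 < #|node G|)%N ->
  reduce_nodes (Z_h h) (c_vec lt a + ratN l) =
  \prod_n pow_coef ((delta_nodes n)%:Z - 2) (N_int n).
Proof.
move=> n2; rewrite /reduce_nodes /fsum /tN /mono.
rewrite (fsbigE (map shifted_point (enum {ffun leaf G -> 'I_N_bound.+1}))) //=;
  first last.
- move=> x _ xN; rewrite Z_hE; case: eqP => [xh|]; last by rewrite mul0r.
  case: (_ =P _) => [xl|]; last by rewrite mulr0.
  have [->|x0] := eqVneq (coef_p x) 0; first by rewrite mul0r.
  have [j xE] := shifted_point_surj x0 xh (esym xl).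
  by rewrite xE map_f ?mem_enum in xN.
- by rewrite map_inj_uniq ?enum_uniq //; exact: shifted_point_inj.
rewrite big_map (eq_bigl xpredT) => [|j]; last by rewrite in_setT.
rewrite big_enum /=.
have nuE n : #|[set u | nu u == n]| = #|node_leaves n|.
  by apply: eq_card => u; rewrite nuP inE eq_sym.
rewrite (eq_bigr (fun j : {ffun leaf G -> 'I_N_bound.+1} =>
  \prod_n pow_coef (exponent (val n))
   (N_int n - \sum_(u | nu u == n) (j u)%:Z))) => [|j _]; last first.
  by rewrite Z_hE class_lift_point // ah eqxx piN_lift_point // eqxx mulr1
    coef_p_shifted_point.
rewrite (sum_pow_coef_all N_int_le) => [|n]; last first.
  have := nbr_nodes_gt0 treeG n n2.
  by rewrite nuE /exponent (valency_node treeG) PoszD; lia.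
apply: eq_bigr => n _; congr (pow_coef _ _).
by rewrite nuE /exponent (valency_node treeG) PoszD; lia.
Qed.

(** A node with one neighbouring node contributes a coefficient of (1-s)^(-1),
    which is 1; with two, a coefficient of 1, and N_a vanishes there on S_a.
    The bounds defining S_a are those of the support. *)
Lemma coef_S_point : (1 < #|node G|)%N ->
  \prod_n pow_coef ((delta_nodes n)%:Z - 2) (N_int n) =
    if l \in Sa lt a then coef_S lt a l else 0.
Proof.
move=> n2; have d0 n := nbr_nodes_gt0 treeG n n2.
case: ifPn => [/set_mem[_ lS]|lN].
  rewrite /coef_S [RHS]big_mkcond; apply: eq_bigr => n _.
  have [N0 N1] := lS n; have := d0 n; rewrite -!N_intK in N0 N1 *.
  rewrite inE in N1; move: N0 N1; rewrite ler0z -[2 : rat]/(2%:~R) pmulrn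
    -rmorphB ler_int.
  case: (N_int n) => // k _ N1; rewrite -[(Posz k)%:~R]/(k%:R) natrK.
  case: (delta_nodes n) N1 => [|[|[|d]]] //= N1 _.
    by move: (N1 isT); case: k {N1}.
  by rewrite natz.
have [n /orP[nN|/andP[n2' nN]]] : exists n, (N_int n < 0) ||
    ((2 <= delta_nodes n)%N && (~~ (N_int n <= (delta_nodes n)%:Z - 2))).
  apply/not_existsP => N; case/negP: lN; apply/mem_set; split=> // n.
  have /negP := N n; rewrite negb_or -leNgt negb_and negbK => /andP[N0 N1].
  rewrite -N_intK ler0z; split=> //; rewrite inE => d2.
  move: N1; rewrite d2 /= => N1.
  by rewrite -[2 : rat]/(2%:~R) pmulrn -rmorphB ler_int.
- by rewrite (bigD1 n) //= pow_coef_lt0 ?mul0r.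
rewrite (bigD1 n) //= -ltNge in nN *.
have -> : pow_coef ((delta_nodes n)%:Z - 2) (N_int n) = 0;
  last by rewrite mul0r.
case: (N_int n) nN => [k|//]; rewrite subzn //= => kd.
by rewrite bin_small ?mulr0.
Qed.

End Point.

Lemma reduce_nodes_Z_h h : is_reduced_lift lt a h -> (1 < #|node G|)%N ->
  reduce_nodes (Z_h h) =
    fsum (Sa lt a) (fun l q => coef_S lt a l * mono (c_vec lt a + ratN l) q).
Proof.
move=> ah n2; apply/funext => q.
have [[l [lZ qE]]|N] := pselect (exists l, ZNa lt a l /\ q =
  c_vec lt a + ratN l).
  rewrite qE (reduce_nodes_point ah lZ) ?coef_S_point //.
  rewrite /fsum (fsbig_single (g := l)) => [|l' _ l'l].
    by rewrite /mono eqxx mulr1.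
  rewrite /mono (inj_eq (addrI _)) (inj_eq (@ratN_inj G)) eq_sym.
  by rewrite (negPf l'l) mulr0.
rewrite /fsum fsbig1 => [|l [lZ _]]; last first.
  rewrite /mono; case: eqP => [qE|]; last by rewrite mulr0.
  by case: N; exists l.
rewrite /reduce_nodes /fsum fsbig1 // => x _; rewrite Z_hE /tN /mono.
case: eqP => [xh|]; last by rewrite mul0r.
case: eqP => [xq|]; last by rewrite mulr0.
have [->|x0] := eqVneq (coef_p x) 0; first by rewrite mul0r.
have [_ xi] := coef_p_support x0.
have [|//|l [f [lZ xE _]]] := lift_point_surj treeG nd minG ltO nuP (a := a)
  (z := x).
  by apply/class_eq; rewrite xh ah.
by case: N; exists l; split=> //; rewrite xq xE piN_lift_point.
Qed.

End ReducedSeries.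

(* The last part needs two nodes: for a single node n the coefficient of the   *)
(* reduced series is N_a(l,n) + 1 rather than the empty product (e.g. E_8).    *)
Theorem proposition3p4p3 (G : plumbing) (lt : rel (node G)) (h : QLmodL G)
    (a : lift_coef G) :
  is_tree G -> negative_definite G -> minimal G -> (0 < #|node G|)%N ->
  is_orientation lt -> Hgrp G h -> is_reduced_lift lt a h ->
  [/\ set_bij (Sa lt a) (Xh h) (x_of lt a),
      forall l, Sa lt a l ->
        tN (x_of lt a l) = mono (c_vec lt a + ratN l) /\
        mono (c_vec lt a + ratN l) =
          \big[@conv _/@sone _]_n
             mono (scaleQ (c_vec lt a n + (l n)%:~R) (Evec n))
    & (1 < #|node G|)%N ->
      reduce_nodes (Z_h h) =
        fsum (Sa lt a) (fun l y => coef_S lt a l * mono (c_vec lt a + ratN l) y)].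
Proof.
move=> treeG nd minG n_gt0 ltO _ ah.
have [nu nuP] := fin_all_exists (fun u => leaf_node treeG u n_gt0).
have /card_gt0P[n0 _] := n_gt0; split.
- exact: (x_of_bij treeG nd minG ltO nuP n0 ah).
- move=> l [lZ _]; split; last exact: mono_nodes.
  by rewrite /tN (x_of_lift_point treeG minG lt a nuP)
    (piN_lift_point treeG nd minG ltO nuP n0).
exact: (reduce_nodes_Z_h treeG nd minG ltO nuP n0 ah).
Qed.
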